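(* There is an algorithm that, given an event graph $G=(V,E)$, a node $v\in V$ and a subset $X\subseteq\mathcal U_{|V}$, decides in $O(|V|+|E|)$ time whether $(v,X)$ is a node of the unique sink component $\mathcal C$ of $\mathrm{dec}(G)$.
   Context: An event graph is a finite, connected, undirected graph $G=(V,E)$, with $n=|V|$, in which every node $v$ carries a label that is either $\mathtt{i}x_v$ (insertion of $x_v$) or $\mathtt{d}x_v$ (deletion of $x_v$), where $x_v$ is an element of a finite universe $\mathcal U$. Write $\mathcal U_{|V}=\{x_v : v\in V\}$. It is assumed that for each $x\in\mathcal U_{|V}$ at least one node is labeled $\mathtt{i}x$ and at least one node is labeled $\mathtt{d}x$. The decorated graph $\mathrm{dec}(G)$ is the directed graph with vertex set $V\times 2^{\mathcal U_{|V}}$ in which $((u,X),(v,Y))$ is an edge if and only if $\{u,v\}\in E$ and $Y=X\cup\{x_v\}$ when $v$ is labeled $\mathtt{i}x_v$, respectively $Y=X\setminus\{x_v\}$ when $v$ is labeled $\mathtt{d}x_v$. A sink component of $\mathrm{dec}(G)$ is a strongly connected component of $\mathrm{dec}(G)$ from which no edge leads to a different strongly connected component; $\mathrm{dec}(G)$ has exactly one sink component, denoted $\mathcal C$. *)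

(* Defs.v *)
From mathcomp Require Import all_boot.
Set Implicit Arguments. Unset Strict Implicit. Unset Printing Implicit Defensive.

(*   lab : node v  |->  (true, x) for label  i x,  (false, x) for  d x *)
(* Elements of the universe that occur in labels are encoded as        *)
(* numbers < n (w.l.o.g., since |U_{|V}| <= |V|).                      *)

Definition is_event_graph (n : nat) (e : rel 'I_n) (lab : 'I_n -> bool * 'I_n) :=
  [/\ symmetric e, irreflexive e, (forall u w, connect e u w) &
      (forall v : 'I_n, (exists u, lab u = (true, (lab v).2)) /\
                        (exists u, lab u = (false, (lab v).2)))].

Definition UV (n : nat) (lab : 'I_n -> bool * 'I_n) : {set 'I_n} :=
  [set (lab v).2 | v in 'I_n].

Definition apply_label (n : nat) (l : bool * 'I_n) (X : {set 'I_n}) : {set 'I_n} :=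
  if l.1 then l.2 |: X else X :\ l.2.

Definition dec_edge (n : nat) (e : rel 'I_n) (lab : 'I_n -> bool * 'I_n) :
  rel ('I_n * {set 'I_n}) :=
  fun p q => e p.1 q.1 && (q.2 == apply_label (lab q.1) p.2).

Definition dec_vertex (n : nat) (lab : 'I_n -> bool * 'I_n) (s : 'I_n * {set 'I_n}) :=
  s.2 \subset UV lab.

(* s is a node of a sink strongly connected component of dec(G):
   every dec-vertex reachable from s lies in the SCC of s.  Since
   dec(G) has exactly one sink component C, this is membership in C. *)
Definition in_sink_component (n : nat) (e : rel 'I_n) (lab : 'I_n -> bool * 'I_n)
    (s : 'I_n * {set 'I_n}) : bool :=
  dec_vertex lab s &&
  [forall t, connect (dec_edge e lab) s t ==> connect (dec_edge e lab) t s].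

(* Cost model: a unit-cost word RAM.                                   *)
(* Memory M : nat -> nat.  Words are bounded by W (a polynomial in the *)
(* input size, as in the word-RAM model); writing a larger value is a  *)
(* fault.                                                              *)

Inductive instr :=
| ISet of nat & nat
| IAdd of nat & nat & nat
| ISub of nat & nat & nat
| ILoad of nat & nat
| IStore of nat & nat
| IJz of nat & nat
| IHalt.

Definition mem_upd (M : nat -> nat) (i x : nat) : nat -> nat :=
  fun a => if a == i then x else M a.

Inductive step_res :=
| Halted of (nat -> nat)
| Next of nat & (nat -> nat)
| Fault.

Definition step (P : seq instr) (W : nat) (pc : nat) (M : nat -> nat) : step_res :=
  match nth IHalt P pc with
  | IHalt => Halted M
  | ISet i k => if k <= W then Next pc.+1 (mem_upd M i k) else Fault
  | IAdd i j k => if M j + M k <= W then Next pc.+1 (mem_upd M i (M j + M k))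
                  else Fault
  | ISub i j k => Next pc.+1 (mem_upd M i (M j - M k))
  | ILoad i j => Next pc.+1 (mem_upd M i (M (M j)))
  | IStore i j => Next pc.+1 (mem_upd M (M i) (M j))
  | IJz i l => Next (if M i == 0 then l else pc.+1) M
  end.

(* exec P W t pc M = Some Mf iff the program halts (reaching IHalt or
   running off the program) after at most t non-halting steps, with
   final memory Mf. *)
Fixpoint exec (P : seq instr) (W : nat) (t : nat) (pc : nat) (M : nat -> nat)
  : option (nat -> nat) :=
  match step P W pc M with
  | Halted Mf => Some Mf
  | Fault => None
  | Next pc' M' => if t is t'.+1 then exec P W t' pc' M' else None
  end.

(* Input encoding.  es is an edge list listing every edge of G exactly *)
(* once (in either orientation).  Memory layout:                       *)
(*   M[0] = n, M[1] = m = |E|, M[2] = v,                               *)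
(*   then n cells: label kinds (1 = insertion, 0 = deletion),          *)
(*   then n cells: label elements,                                     *)
(*   then n cells: characteristic vector of X,                         *)
(*   then 2m cells: the edge list; all other cells are 0.              *)
(* The answer is read from M[0] on halting (1 = yes).                  *)

Definition represents (n : nat) (e : rel 'I_n) (es : seq ('I_n * 'I_n)) :=
  (forall u w, e u w = ((u, w) \in es) || ((w, u) \in es)) /\
  uniq [seq [set p.1; p.2] | p <- es].

Definition encode (n : nat) (lab : 'I_n -> bool * 'I_n) (es : seq ('I_n * 'I_n))
    (v : 'I_n) (X : {set 'I_n}) : nat -> nat :=
  let data :=
    [seq nat_of_bool (lab i).1 | i <- enum 'I_n] ++
    [seq val (lab i).2 | i <- enum 'I_n] ++
    [seq nat_of_bool (i \in X) | i <- enum 'I_n] ++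
    flatten [seq [:: val p.1; val p.2] | p <- es] in
  fun a => if a == 0 then n else if a == 1 then size es else if a == 2 then val v
           else nth 0 data (a - 3).

(* Main.v *)
Require Import Defs.
From mathcomp Require Import all_boot zify.

Set Implicit Arguments.
Unset Strict Implicit.
Unset Printing Implicit Defensive.

(* A walk that meets every element ends in a set that does not depend on where
   it started, so (v, X) lies in the sink component iff some walk that meets
   every element ends in (v, X).  Read backwards from v, such a walk must show
   each element x for the first time at a node labelled ix if x is in X, and dx
   otherwise; once x has been seen, all nodes labelled with x are free.  Hence a
   greedy search from v decides the question: a node can be entered from a
   visited neighbour if its label agrees with X or if its element was seen, and
   the answer is yes iff every node is visited.

   For the linear running time the search runs on 2n vertices, the nodes and the
   elements, with an arc pair {w, x_w} for each node w next to the edges of G.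
   An arc from a node sets the first flag of its target, an arc from an element
   the second one; the second flag of elements and of nodes that agree with X is
   set from the start, and a vertex is visited when it has both flags. *)

(** * Structured commands and their compilation *)

(** Greed is harmless because no visit closes an option: what a backward walk meets later happened
    earlier, and earlier events of an element already seen are overwritten. So a walk can always be
    retraced to [v] and continued from there, and a permission is never lost.

    The element vertices keep the search linear: joining all nodes with a common element directly
    can take quadratically many arcs, while there are only n pairs {w, x_w}. Entering a node needs
    both a visited neighbour and a permission; this conjunction is not plain reachability, hence the
    two flags.

    The machine shapes the rest. It has no multiplication, and the input leaves no cell free, so the
    work is done in arrays of stride S = 64 (n + m). The factor 64 is reached by six doublings and
    leaves room in each array for the input with the appended pairs, for the arc numbers and for the
    queue. *)

Notation memory := (nat -> nat).

(** The remaining fuel [k] is arbitrary, so runs compose without a case analysis on when the fuel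
    ends. *)
Definition steps P W t pc M pc' M' :=
  forall k, exec P W (t + k) pc M = exec P W k pc' M'.

Lemma steps_refl P W pc M : steps P W 0 pc M pc M.
Proof. by []. Qed.

Lemma steps_trans P W t1 t2 pc1 M1 pc2 M2 pc3 M3 :
  steps P W t1 pc1 M1 pc2 M2 -> steps P W t2 pc2 M2 pc3 M3 ->
  steps P W (t1 + t2) pc1 M1 pc3 M3.
Proof. by move=> H1 H2 k; rewrite -addnA H1 H2. Qed.

Lemma steps1 P W pc M pc' M' :
  step P W pc M = Next pc' M' -> steps P W 1 pc M pc' M'.
Proof. by move=> H k; rewrite add1n /= H. Qed.

Definition code_at P o (code : seq instr) :=
  forall i, i < size code -> nth IHalt P (o + i) = nth IHalt code i.

Lemma code_at_cat P o c1 c2 :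
  code_at P o (c1 ++ c2) -> code_at P o c1 /\ code_at P (o + size c1) c2.
Proof.
move=> H; split=> i lti.
  by rewrite H ?nth_cat ?lti // size_cat ltn_addr.
rewrite -addnA H; first by rewrite nth_cat ltnNge leq_addr addKn.
by rewrite size_cat ltn_add2l.
Qed.

Lemma code_at_cons P o i c :
  code_at P o (i :: c) -> nth IHalt P o = i /\ code_at P o.+1 c.
Proof.
move=> /(@code_at_cat _ _ [:: i]) [/(_ 0 isT)]; rewrite addn0 addn1 /=.
by split.
Qed.

Definition wpi W (i : instr) (Q : memory -> Prop) (M : memory) : Prop :=
  match i with
  | ISet r k => k <= W /\ Q (mem_upd M r k)
  | IAdd r j k => M j + M k <= W /\ Q (mem_upd M r (M j + M k))
  | ISub r j k => Q (mem_upd M r (M j - M k))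
  | ILoad r j => Q (mem_upd M r (M (M j)))
  | IStore r j => Q (mem_upd M (M r) (M j))
  | _ => False
  end.

Lemma wpi_step P W i Q pc M :
  wpi W i Q M -> nth IHalt P pc = i ->
  exists2 M', Q M' & steps P W 1 pc M pc.+1 M'.
Proof.
move=> H Hi; case: i H Hi => //= [r k|r j k|r j k|r j|r j].
1,2: by move=> [leW HQ] Hi; eexists; first exact: HQ;
  apply: steps1; rewrite /step Hi leW.
all: by move=> HQ Hi; eexists; first exact: HQ; apply: steps1; rewrite /step Hi.
Qed.

Definition wpl W (l : seq instr) (Q : memory -> Prop) : memory -> Prop :=
  foldr (wpi W) Q l.

Lemma wpi_mono W i (Q Q' : memory -> Prop) M :
  (forall M', Q M' -> Q' M') -> wpi W i Q M -> wpi W i Q' M.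
Proof. by move=> H; case: i => /= *; intuition. Qed.

Lemma wpl_mono W l (Q Q' : memory -> Prop) M :
  (forall M', Q M' -> Q' M') -> wpl W l Q M -> wpl W l Q' M.
Proof.
by move=> H; elim: l M => [|i l IH] M /=; [apply: H | apply: wpi_mono].
Qed.

Lemma wpl_cat W l1 l2 Q M :
  wpl W (l1 ++ l2) Q M <-> wpl W l1 (wpl W l2 Q) M.
Proof. by rewrite /wpl foldr_cat. Qed.

Lemma wpl_steps P W l Q pc M :
  wpl W l Q M -> code_at P pc l ->
  exists2 M', Q M' & steps P W (size l) pc M (pc + size l) M'.
Proof.
elim: l pc M => [|i l IH] pc M /=.
  by move=> HQ _; exists M; rewrite ?addn0 //; apply: steps_refl.
move=> H /code_at_cons[Hi Hl].
have [M1 /IH /(_ Hl) [M2 HQ H2] H1] := wpi_step H Hi.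
exists M2 => //; rewrite -addSnnS -add1n.
exact: steps_trans H1 H2.
Qed.

(** Invariant rule for repetitions that are unrolled into the instruction list, as in [prologue]. *)
Lemma wpl_iter W (ins : nat -> seq instr) (I : nat -> memory -> Prop) k M :
  (forall i M', i < k -> I i M' -> wpl W (ins i) (I i.+1) M') ->
  I 0 M -> wpl W (flatten [seq ins i | i <- iota 0 k]) (I k) M.
Proof.
elim: k => [|k IH] // H I0.
rewrite -{1}addn1 iotaD map_cat flatten_cat /= cats0 add0n; apply/wpl_cat.
apply: wpl_mono (IH _ I0); first by move=> M'; apply: H.
by move=> i M' lti; apply: H; apply: leqW.
Qed.

(** Cells 0 to 19 are registers, cells 20 to 29 hold the base addresses of the ten arrays, so that
    array access needs no multiplication, and cell 30 is scratch. *)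
Notation nregs := 20.
Notation narrs := 10.
Notation rtmp := 30.
Notation nlow := 31.

Record state := State { reg : nat -> nat; arr : nat -> nat -> nat }.

Definition arr_upd (A : nat -> nat -> nat) j i x : nat -> nat -> nat :=
  fun j' i' => if (j' == j) && (i' == i) then x else A j' i'.

(* Array [j] occupies the cells [j * S + i] with [i < S]; array [0] is the
   initial memory itself, without its first [nlow] cells. *)
Inductive cmd :=
| CSet of nat & nat
| CAdd of nat & nat & nat
| CSub of nat & nat & nat
| CLoad of nat & nat & nat
| CStore of nat & nat & nat
| CSeq of cmd & cmd
| CIf of nat & cmd & cmd
| CWhile of nat & cmd.

(** Jump targets are absolute, so the offset [o] is passed down. Clearing [rtmp] and testing it is
    an unconditional jump; the summand 2 skips that pair. *)
Fixpoint compile (o : nat) (c : cmd) : seq instr :=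
  match c with
  | CSet r k => [:: ISet r k]
  | CAdd r i j => [:: IAdd r i j]
  | CSub r i j => [:: ISub r i j]
  | CLoad r a i => [:: IAdd rtmp (nregs + a) i; ILoad r rtmp]
  | CStore a i r => [:: IAdd rtmp (nregs + a) i; IStore rtmp r]
  | CSeq c1 c2 => let l1 := compile o c1 in l1 ++ compile (o + size l1) c2
  | CIf r c1 c2 =>
      let l1 := compile o.+1 c1 in
      let o2 := o.+1 + size l1 + 2 in
      let l2 := compile o2 c2 in
      IJz r o2 :: l1 ++ [:: ISet rtmp 0; IJz rtmp (o2 + size l2)] ++ l2
  | CWhile r c =>
      let l := compile o.+1 c in
      IJz r (o.+1 + size l + 2) :: l ++ [:: ISet rtmp 0; IJz rtmp o]
  end.

Fixpoint wf (c : cmd) : bool :=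
  match c with
  | CSet r _ => r < nregs
  | CAdd r i j | CSub r i j => [&& r < nregs, i < nregs & j < nregs]
  | CLoad r a i | CStore a i r => [&& r < nregs, a < narrs & i < nregs]
  | CSeq c1 c2 => wf c1 && wf c2
  | CIf r c1 c2 => [&& r < nregs, wf c1 & wf c2]
  | CWhile r c => (r < nregs) && wf c
  end.

(** The 3 of a conditional pays for the test and the jump pair. The value for [CWhile] is a
    placeholder: [wp] rejects loops and [triple_while] counts them. *)
Fixpoint cost (c : cmd) : nat :=
  match c with
  | CSet _ _ | CAdd _ _ _ | CSub _ _ _ => 1
  | CLoad _ _ _ | CStore _ _ _ => 2
  | CSeq c1 c2 => cost c1 + cost c2
  | CIf _ c1 c2 => cost c1 + cost c2 + 3
  | CWhile _ _ => 0
  end.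

(** * Weakest preconditions and timed triples *)

Section Semantics.

Variables W S : nat.

(** Array 0 overlaps the registers, hence the bound [nlow] in the last clause. Cell [rtmp] is left
    unconstrained. *)
Definition encodes (s : state) (M : memory) :=
  [/\ forall r, r < nregs -> M r = reg s r,
      forall j, j < narrs -> M (nregs + j) = j * S
    & forall j i, j < narrs -> i < S -> nlow <= j * S + i ->
      M (j * S + i) = arr s j i].

Definition valid a i := i < S /\ nlow <= a * S + i.

Fixpoint wp (c : cmd) (Q : state -> Prop) (s : state) : Prop :=
  match c with
  | CSet r k => k <= W /\ Q (State (mem_upd (reg s) r k) (arr s))
  | CAdd r i j =>
      reg s i + reg s j <= W /\
      Q (State (mem_upd (reg s) r (reg s i + reg s j)) (arr s))
  | CSub r i j => Q (State (mem_upd (reg s) r (reg s i - reg s j)) (arr s))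
  | CLoad r a i =>
      valid a (reg s i) /\
      Q (State (mem_upd (reg s) r (arr s a (reg s i))) (arr s))
  | CStore a i r =>
      valid a (reg s i) /\
      Q (State (reg s) (arr_upd (arr s) a (reg s i) (reg s r)))
  | CSeq c1 c2 => wp c1 (wp c2 Q) s
  | CIf r c1 c2 =>
      (reg s r <> 0 -> wp c1 Q s) /\ (reg s r = 0 -> wp c2 Q s)
  | CWhile _ _ => False
  end.

Definition triple (c : cmd) (s : state) (t : nat) (Q : state -> Prop) :=
  forall P o M, code_at P o (compile o c) -> encodes s M ->
  exists t' s' M', [/\ t' <= t, Q s', encodes s' M' &
    steps P W t' o M (o + size (compile o c)) M'].

Hypothesis leSW : narrs * S <= W.
Hypothesis lenlowS : nlow <= S.

Lemma encodes_reg s M r x M' :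
  encodes s M -> r < nregs -> (forall a, a != rtmp -> M' a = mem_upd M r x a) ->
  encodes (State (mem_upd (reg s) r x) (arr s)) M'.
Proof.
move=> [Hr Hb Ha] ltr HM; split=> /=.
- move=> q ltq; rewrite HM /mem_upd; last by lia.
  by case: eqP => // _; apply: Hr.
- move=> j ltj; rewrite HM /mem_upd; last by lia.
  by case: eqP => [|_]; [lia | apply: Hb].
- move=> j i ltj lti le; rewrite HM /mem_upd; last by lia.
  by case: eqP => [|_]; [lia | apply: Ha].
Qed.

Lemma encodes_arr s M a i x M' :
  encodes s M -> a < narrs -> i < S -> nlow <= a * S + i ->
  (forall b, b != rtmp -> M' b = mem_upd M (a * S + i) x b) ->
  encodes (State (reg s) (arr_upd (arr s) a i x)) M'.
Proof.
move=> [Hr Hb Ha] lta lti le HM; split=> /=.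
- move=> q ltq; rewrite HM /mem_upd; last by lia.
  by case: eqP => [|_]; [lia | apply: Hr].
- move=> j ltj; rewrite HM /mem_upd; last by lia.
  by case: eqP => [|_]; [lia | apply: Hb].
- move=> j k ltj ltk le'; rewrite HM /mem_upd /arr_upd; last by lia.
  have S_gt0 : 0 < S by lia.
  (* Distinct arrays do not overlap: both offsets are below S, so division by S recovers the array
     index. *)
  have -> : (j * S + k == a * S + i) = (j == a) && (k == i).
    apply/eqP/andP => [E|[/eqP-> /eqP->] //].
    have := f_equal (fun z => z %/ S) E; rewrite !divnMDl // !divn_small // !addn0.
    by move=> ja; move: E; rewrite ja => /addnI->; rewrite !eqxx.
  by case: ifP => // _; apply: Ha.
Qed.

Lemma encodes_tmp s M x : encodes s M -> encodes s (mem_upd M rtmp x).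
Proof.
move=> [Hr Hb Ha]; split=> [r lt|j lt|j i ltj lti le]; rewrite /mem_upd;
  (case: eqP => [|_]; [lia|]); auto.
Qed.

Lemma jump_tmp P o l s M :
  code_at P o [:: ISet rtmp 0; IJz rtmp l] -> encodes s M ->
  exists2 M', encodes s M' & steps P W 2 o M l M'.
Proof.
move=> /code_at_cons[H1 /code_at_cons[H2 _]] HM.
exists (mem_upd M rtmp 0); first exact: encodes_tmp.
apply: (@steps_trans _ _ 1 1 _ _ o.+1 (mem_upd M rtmp 0)).
  by apply: steps1; rewrite /step H1.
by apply: steps1; rewrite /step H2 /mem_upd eqxx.
Qed.

Lemma triple_wp c s Q : wf c -> wp c Q s -> triple c s (cost c) Q.
Proof.
elim: c s Q => [r k|r i j|r i j|r a i|a i r|c1 IH1 c2 IH2|r c1 IH1 c2 IH2|r c IH] s Q //=.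
- move=> ltr [leW HQ] P o M HC HM.
  have Hw : wpl W (compile o (CSet r k)) (encodes (State (mem_upd (reg s) r k) (arr s))) M.
    by split=> //; apply: encodes_reg HM ltr _.
  have [M' HM' HS] := wpl_steps Hw HC.
  by exists 1, (State (mem_upd (reg s) r k) (arr s)), M'; split.
- move=> /and3P[ltr lti ltj] [leW HQ] P o M HC HM; have [Hr _ _] := HM.
  set s' := State _ _ in HQ.
  have Hw : wpl W (compile o (CAdd r i j)) (encodes s') M.
    by rewrite /= !Hr //; split=> //; apply: encodes_reg HM ltr _.
  have [M' HM' HS] := wpl_steps Hw HC.
  by exists 1, s', M'; split.
- move=> /and3P[ltr lti ltj] HQ P o M HC HM; have [Hr _ _] := HM.
  set s' := State _ _ in HQ.
  have Hw : wpl W (compile o (CSub r i j)) (encodes s') M.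
    by rewrite /= !Hr //; apply: encodes_reg HM ltr _.
  have [M' HM' HS] := wpl_steps Hw HC.
  by exists 1, s', M'; split.
- move=> /and3P[ltr lta lti] [[ltS le] HQ] P o M HC HM; have [Hr Hb Ha] := HM.
  set s' := State _ _ in HQ.
  have Hw : wpl W (compile o (CLoad r a i)) (encodes s') M.
    rewrite /= (Hb a) // (Hr i) //; split.
      have : a * S <= 9 * S by rewrite leq_mul2r; lia.
      lia.
    have -> : mem_upd M rtmp (a * S + reg s i) rtmp = a * S + reg s i.
      by rewrite /mem_upd eqxx.
    apply: encodes_reg HM ltr _ => b Hb'; rewrite /mem_upd; case: eqP => _; last first.
      by rewrite (negbTE Hb').
    by case: eqP => [|_]; [lia | apply: Ha].
  have [M' HM' HS] := wpl_steps Hw HC.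
  by exists 2, s', M'; split.
- move=> /and3P[ltr lta lti] [[ltS le] HQ] P o M HC HM; have [Hr Hb Ha] := HM.
  set s' := State _ _ in HQ.
  have Hw : wpl W (compile o (CStore a i r)) (encodes s') M.
    rewrite /= (Hb a) // (Hr i) //; split.
      have : a * S <= 9 * S by rewrite leq_mul2r; lia.
      lia.
    have -> : mem_upd M rtmp (a * S + reg s i) rtmp = a * S + reg s i.
      by rewrite /mem_upd eqxx.
    have -> : mem_upd M rtmp (a * S + reg s i) r = reg s r.
      by rewrite /mem_upd; case: eqP => [|_]; [lia | apply: Hr].
    apply: encodes_arr HM lta ltS le _ => b Hb'; rewrite /mem_upd; case: eqP => // _.
    by rewrite (negbTE Hb').
  have [M' HM' HS] := wpl_steps Hw HC.
  by exists 2, s', M'; split.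
- move=> /andP[w1 w2] Hw P o M /code_at_cat[C1 C2] HM.
  have [t1 [s1 [M1 [le1 Q1 R1 S1]]]] := IH1 _ _ w1 Hw P o M C1 HM.
  have [t2 [s2 [M2 [le2 Q2 R2 S2]]]] := IH2 _ _ w2 Q1 P _ M1 C2 R1.
  exists (t1 + t2), s2, M2; split=> //; first exact: leq_add.
  rewrite size_cat addnA; exact: steps_trans S1 S2.
- move=> /and3P[ltr w1 w2] [Ht Hf] P o M /=.
  set l1 := compile _ c1; set o2 := _ + 2; set l2 := compile _ c2.
  move=> /code_at_cons[J1 /code_at_cat[C1 /(@code_at_cat _ _ [:: _; _])[J2 C2]]] HM.
  have [Hr _ _] := HM.
  have eo : o + size (IJz r o2 :: l1 ++ [:: ISet rtmp 0, IJz rtmp (o2 + size l2) & l2])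
      = o2 + size l2 by rewrite /= size_cat /= /o2; lia.
  rewrite eo.
  case: (eqVneq (reg s r) 0) => r0.
    have [t2 [s2 [M2 [le2 Q2 R2 S2]]]] := IH2 _ _ w2 (Hf r0) P _ M C2 HM.
    exists (1 + t2), s2, M2; split=> //; first by lia.
    by apply: steps_trans S2; apply: steps1; rewrite /step J1 Hr // r0.
  have [t1 [s1 [M1 [le1 Q1 R1 S1]]]] := IH1 _ _ w1 (Ht (elimN eqP r0)) P _ M C1 HM.
  have [M2 R2 S2] := jump_tmp J2 R1.
  exists (1 + (t1 + 2)), s1, M2; split=> //; first by lia.
  apply: steps_trans (steps_trans S1 S2); apply: steps1.
  by rewrite /step J1 Hr // (negbTE r0).
Qed.

Lemma triple_seq c1 c2 s t1 t2 Q1 Q :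
  triple c1 s t1 Q1 -> (forall s', Q1 s' -> triple c2 s' t2 Q) ->
  triple (CSeq c1 c2) s (t1 + t2) Q.
Proof.
move=> T1 T2 P o M /code_at_cat[C1 C2] HM.
have [u1 [s1 [M1 [le1 H1 R1 S1]]]] := T1 P o M C1 HM.
have [u2 [s2 [M2 [le2 H2 R2 S2]]]] := T2 _ H1 P _ M1 C2 R1.
exists (u1 + u2), s2, M2; split=> //; first exact: leq_add.
rewrite /= size_cat addnA; exact: steps_trans S1 S2.
Qed.

(** The index of the invariant is a variant that drops by one per round. Each round adds the test
    and the jump back to the body; the final 1 is the failing test. *)
Lemma triple_while r c (I : nat -> state -> Prop) (Q : state -> Prop) k s :
  r < nregs -> wf c -> I k s ->
  (forall k' s', I k' s' -> reg s' r <> 0 -> 0 < k' /\ wp c (I k'.-1) s') ->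
  (forall k' s', I k' s' -> reg s' r = 0 -> Q s') ->
  triple (CWhile r c) s (k * (cost c + 3) + 1) Q.
Proof.
move=> ltr wc Ik HI HQ P o; set t := cost c + 3.
have -> : size (compile o (CWhile r c)) = (size (compile o.+1 c)).+3.
  by rewrite /= size_cat addn2.
move: {2}k (leqnn k) => N; elim: N => [|N IH] in k s Ik *.
  rewrite leqn0 => /eqP k0 M /code_at_cons[J1 C] HM; have [Hr _ _] := HM.
  case: (eqVneq (reg s r) 0) => r0; last first.
    by case: (HI _ _ Ik (elimN eqP r0)); rewrite k0.
  exists 1, s, M; split=> //; [exact: leq_addl | exact: HQ Ik r0 |].
  apply: steps1; rewrite /step J1 Hr // r0 eqxx; congr Next; by rewrite -/compile addn2 addSn !addnS.
move=> lekN M C HM; have [Hr _ _] := HM.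
have /code_at_cons[J1 /code_at_cat[C1 J2]] := C.
case: (eqVneq (reg s r) 0) => r0.
  exists 1, s, M; split=> //; [exact: leq_addl | exact: HQ Ik r0 |].
  apply: steps1; rewrite /step J1 Hr // r0 eqxx; congr Next; by rewrite -/compile addn2 addSn !addnS.
have [k_gt0 Hw] := HI _ _ Ik (elimN eqP r0).
have [t1 [s1 [M1 [le1 I1 R1 S1]]]] := triple_wp wc Hw C1 HM.
have [M2 R2 S2] := jump_tmp J2 R1.
have [|t3 [s3 [M3 [le3 I3 R3 S3]]]] := IH _ _ I1 _ M2 C R2; first by lia.
exists (1 + (t1 + 2) + t3), s3, M3; split=> //.
  have : k * t = k.-1 * t + t by rewrite -{1}(prednK k_gt0) mulSn addnC.
  by move: le3; rewrite /t; lia.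
apply: steps_trans S3; apply: steps_trans (steps_trans S1 S2); apply: steps1.
by rewrite /step J1 Hr // (negbTE r0).
Qed.

Lemma triple_le c s t t' Q : t <= t' -> triple c s t Q -> triple c s t' Q.
Proof.
move=> le T P o M C HM; have [u [s' [M' [? ? ? ?]]]] := T P o M C HM.
by exists u, s', M'; split=> //; lia.
Qed.

End Semantics.

(** * The sink component and backward search *)

Section SinkComponent.

Variables (n : nat) (e : rel 'I_n) (lab : 'I_n -> bool * 'I_n).
Variables (v : 'I_n) (X : {set 'I_n}).
Hypothesis G_event : is_event_graph e lab.
Hypothesis subX : X \subset UV lab.

Definition compat (w : 'I_n) : bool := (lab w).1 == ((lab w).2 \in X).

(** Permissions only grow, so no order of visits has to be recorded. *)
Inductive found : 'I_n -> Prop :=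
| found_start : compat v -> found v
| found_compat u w : found u -> e u w -> compat w -> found w
| found_seen u u' w : found u -> e u w -> found u' -> (lab u').2 = (lab w).2 -> found w.

Lemma found_root w : found w -> found v.
Proof. by elim=> // cv; exact: found_start. Qed.

Let sym_e : symmetric e. Proof. by case: G_event. Qed.

(** By [foldr] the head of [q] is the last event, so a backward walk is listed in the order in which
    it is walked. *)
Definition replay (q : seq 'I_n) (Y : {set 'I_n}) : {set 'I_n} :=
  foldr (fun u Z => apply_label (lab u) Z) Y q.

Definition elems (q : seq 'I_n) := [seq (lab u).2 | u <- q].

Lemma in_apply_label x l (Y : {set 'I_n}) :
  (x \in apply_label l Y) = if x == l.2 then l.1 else x \in Y.
Proof. by rewrite /apply_label; case: l.1; rewrite !inE; case: eqP. Qed.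

Lemma replay_notin q Y x : x \notin elems q -> (x \in replay q Y) = (x \in Y).
Proof.
elim: q => //= u q IH; rewrite inE negb_or => /andP[xu /IH <-].
by rewrite in_apply_label (negbTE xu).
Qed.

(** The event of [x] nearest to the head decides, whatever the initial set. *)
Lemma replay_in q Y Y' x :
  x \in elems q -> (x \in replay q Y) = (x \in replay q Y').
Proof.
elim: q => //= u q IH; rewrite inE !in_apply_label.
by case: eqP => //= _ /IH.
Qed.

Lemma replay_cat q r Y : replay (q ++ r) Y = replay q (replay r Y).
Proof. exact: foldr_cat. Qed.

Definition good q := forall x Y, x \in elems q -> (x \in replay q Y) = (x \in X).

(** The events of [r] happen before those of [q], which overwrite them. *)
Lemma good_cat q r : good q -> {subset elems r <= elems q} -> good (q ++ r).
Proof.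
move=> gq sub x Y; rewrite /elems map_cat mem_cat replay_cat => Hx.
by apply: gq; case/orP: Hx => // /sub.
Qed.

Lemma good_prefix q r : good (q ++ r) -> good q.
Proof.
move=> g x Y Hx; rewrite (replay_in Y (replay r Y) Hx) -replay_cat g //.
by rewrite /elems map_cat mem_cat Hx.
Qed.

Lemma good_rcons q w : good q -> compat w -> good (rcons q w).
Proof.
move=> gq /eqP cw x Y; rewrite -cats1 replay_cat [elems _]map_cat mem_cat -/(elems q).
have [Hx _|Hx] := boolP (x \in elems q); first exact: gq.
by rewrite /= mem_seq1 => /eqP E; rewrite replay_notin // in_apply_label E eqxx.
Qed.

Lemma good_rcons_compat q w :
  good (rcons q w) -> (lab w).2 \notin elems q -> compat w.
Proof.
move=> g Hx; have := g (lab w).2 set0.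
rewrite -cats1 replay_cat replay_notin //= in_apply_label eqxx /elems map_cat mem_cat /=.
by rewrite mem_seq1 eqxx orbT /compat => ->.
Qed.

(** Quantifying over all good walks [p] lets the extensions be chained, which the case [found_seen]
    needs. *)
Lemma found_walk w : found w ->
  forall p, path e v p -> good (v :: p) ->
  exists p', [/\ path e v (p ++ p'), good (v :: p ++ p') & last v (p ++ p') = w].
Proof.
elim=> {w} [cv|u w _ IH euw cw|u u' w _ IH euw _ IH' elw] p pp gp.
(* Retracing the walk to [v] meets only elements already seen. *)
- exists (rev (belast v p)); rewrite cat_path pp rev_path.
  have -> : path (fun x y => e y x) v p by rewrite -(eq_path (e:=e)).
  split=> //.
    rewrite -cat_cons; apply: good_cat => // x /mapP[u]; rewrite mem_rev => /mem_belast Hu ->.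
    exact: (map_f (fun u => (lab u).2)).
  rewrite last_cat; case: p {pp gp} => //= a p.
  by rewrite rev_cons last_rcons.
- have [p' [pp' gp' lp]] := IH p pp gp; rewrite -lp in euw.
  exists (rcons p' w); rewrite -rcons_cat rcons_path last_rcons pp' euw.
  by split=> //; rewrite -rcons_cons; apply: good_rcons.
(* Go to [u'] first, so that the element of [w] is seen, then to [u], and step to [w]. *)
- have [p' [pp' gp' lp']] := IH' p pp gp.
  have [r [pr gr lr]] := IH _ pp' gp'.
  exists (rcons (p' ++ r) w); rewrite -rcons_cat rcons_path last_rcons catA pr lr euw.
  split=> //; rewrite -rcons_cons -cats1; apply: good_cat => // x.
  rewrite mem_seq1 => /eqP->; rewrite -elw; apply: (map_f (fun u => (lab u).2)).
  by rewrite -cat_cons mem_cat -lp' mem_last.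
Qed.

Lemma compat_root w : found w -> compat v.
Proof. by elim. Qed.

Lemma good1 : compat v -> good [:: v].
Proof. by move=> cv; apply: (@good_rcons [::]). Qed.

Lemma found_all_walk : (forall w, found w) ->
  exists p, [/\ path e v p, good (v :: p) & forall w, w \in v :: p].
Proof.
move=> fall.
suff H (s : seq 'I_n) : exists p, [/\ path e v p, good (v :: p) & {subset s <= v :: p}].
  have [p [pp gp sp]] := H (enum 'I_n); exists p; split=> // w.
  by apply: sp; rewrite mem_enum.
elim: s => [|w s [p [pp gp sp]]].
  by exists [::]; split=> //; apply: good1; apply: compat_root (fall v).
have [r [pr gr lr]] := found_walk (fall w) pp gp.
exists (p ++ r); split=> // u; rewrite -lr inE => /orP[/eqP->|/sp Hu].
  exact: mem_last.
by rewrite -cat_cons mem_cat Hu.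
Qed.

Lemma dec_connect_lift a b Y : connect e a b ->
  exists Z, connect (dec_edge e lab) (a, Y) (b, Z).
Proof.
move=> /connectP[p pp ->]; elim: p a Y pp => [|c p IH] a Y /=; first by exists Y.
move=> /andP[eac /(IH _ (apply_label (lab c) Y)) [Z HZ]]; exists Z.
by apply: connect_trans HZ; apply: connect1; rewrite /dec_edge eac /=.
Qed.

(** An edge of dec(G) applies the label of the node it enters. Starting one step outside the walk,
    at [a], makes every node of [v :: p] an event. *)
Lemma dec_connect_replay a p Y : path e v p -> e a (last v p) ->
  connect (dec_edge e lab) (a, Y) (v, replay (v :: p) Y).
Proof.
elim/last_ind: p a Y => [|p b IH] a Y.
  by move=> _ eav; apply: connect1; rewrite /dec_edge eav /=.
rewrite rcons_path last_rcons => /andP[pp epb] eab.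
apply: connect_trans (_ : connect _ (b, apply_label (lab b) Y) _).
  by apply: connect1; rewrite /dec_edge eab /=.
have -> : replay (v :: rcons p b) Y = replay (v :: p) (apply_label (lab b) Y).
  by rewrite -rcons_cons -cats1 replay_cat.
by apply: IH; rewrite // sym_e.
Qed.

Lemma dec_edge_vertex s t : dec_vertex lab s -> dec_edge e lab s t -> dec_vertex lab t.
Proof.
rewrite /dec_vertex => Hs /andP[_ /eqP ->]; apply/subsetP => x.
rewrite in_apply_label; case: eqP => [-> _|_]; last exact: (subsetP Hs).
exact: imset_f.
Qed.

Lemma dec_connect_vertex s t :
  dec_vertex lab s -> connect (dec_edge e lab) s t -> dec_vertex lab t.
Proof.
move=> Hs /connectP[p pp ->]; elim: p s Hs pp => //= a p IH s Hs /andP[/(dec_edge_vertex Hs)].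
exact: IH.
Qed.

(** The element of [w] is both inserted and deleted, by two distinct nodes; so there is a second
    node, and connectivity gives an edge. *)
Lemma neighbor w : exists u, e u w.
Proof.
have [_ _ conn labs] := G_event.
have [u wu] : exists u, u != w.
  have [[u1 l1] [u2 l2]] := labs w.
  case: (eqVneq u1 w) => [E1|]; last by exists u1.
  exists u2; apply: contraPneq l2 => E2; move: l1; rewrite E1 E2 => ->.
  by [].
have /connectP[p pp E] := conn w u.
case: p pp E => [_ E|a p /= /andP[ewa _] _]; first by rewrite E eqxx in wu.
by exists a; rewrite sym_e.
Qed.

Lemma found_sink : (forall w, found w) -> in_sink_component e lab (v, X).
Proof.
move=> fall; rewrite /in_sink_component {1}/dec_vertex subX /=.
have [p [pp gp sp]] := found_all_walk fall.
have [a ea] := neighbor (last v p).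
apply/forallP=> -[b Y]; apply/implyP=> conY.
have [_ _ conn _] := G_event.
have [Z HZ] := dec_connect_lift Y (conn b a).
have /subsetP subZ : dec_vertex lab (a, Z).
  by apply: dec_connect_vertex (connect_trans conY HZ).
apply: connect_trans HZ _.
suff -> : X = replay (v :: p) Z by exact: dec_connect_replay.
(* Elements in labels are all seen on the walk; the others are in neither X nor Z. *)
apply/setP=> x; case: (boolP (x \in UV lab)) => [/imsetP[w _ ->]|xUV].
  by rewrite gp //; apply: (map_f (fun u => (lab u).2)).
have xX : x \notin X by apply: contra xUV; apply: (subsetP subX).
rewrite (negbTE xX) replay_notin; first by apply/esym/negbTE; apply: contra xUV => /subZ.
by apply: contra xUV => /mapP[w _ ->]; apply: imset_f.
Qed.

(** Each new node either repeats an element or shows it for the first time, and then goodness forces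
    agreement with X. *)
Lemma good_found q : path e v q -> good (v :: q) -> forall w, w \in v :: q -> found w.
Proof.
elim/last_ind: q => [_ /(@good_rcons_compat [::]) H w|q a IH].
  by rewrite mem_seq1 => /eqP->; apply: found_start; apply: H.
rewrite rcons_path -rcons_cons => /andP[pp ea] gq.
have {}IH : forall w, w \in v :: q -> found w.
  by apply: IH pp _; apply: (@good_prefix _ [:: a]); rewrite cats1.
move=> w; rewrite mem_rcons inE => /orP[/eqP->|/IH //].
have Hl := IH _ (mem_last v q).
case: (boolP ((lab a).2 \in elems (v :: q))) => [/mapP[u /IH fu E]|/(good_rcons_compat gq)].
  exact: found_seen Hl ea fu (esym E).
exact: found_compat Hl ea.
Qed.

(* Every event of a [dec] path is one of its nodes except the first. *)
Lemma dec_path_replay s p : path (dec_edge e lab) s p ->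
  path e (last s p).1 (rev (map fst (belast s p))) /\
  (last s p).2 = replay (rev (map fst p)) s.2.
Proof.
elim/last_ind: p => //= p t IH; rewrite rcons_path => /andP[/IH [pp E] /andP[est /eqP E2]].
rewrite last_rcons belast_rcons lastI !map_rcons !rev_rcons /= -E E2 sym_e est.
by split.
Qed.

Lemma sink_found w : in_sink_component e lab (v, X) -> found w.
Proof.
move=> /andP[_ /forallP sink].
(* A closed walk from (v, X) through [u] is reversed. If [u] differs from [v], the outward part is
   nonempty and [u] is an event; [v] then follows from a neighbour by [found_root]. *)
suff H u : u != v -> found u.
  case: (eqVneq w v) => [->|]; last exact: H.
  have [u euv] := neighbor v.
  suff /found_root : found u by [].
  by apply: H; apply: contraTneq euv => ->; case: G_event => _ ->.
move=> uv; have [_ _ conn _] := G_event.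
have [Z con1] := dec_connect_lift X (conn v u).
have /connectP[p2 path2 last2] := implyP (sink (u, Z)) con1.
have /connectP[p1 path1 last1] := con1.
have path12 : path (dec_edge e lab) (v, X) (p1 ++ p2) by rewrite cat_path path1 -last1.
have last12 : last (v, X) (p1 ++ p2) = (v, X) by rewrite last_cat -last1.
have [pe rep] := dec_path_replay path12.
have up : u \in map fst (p1 ++ p2).
  rewrite map_cat mem_cat; apply/orP; left.
  case: p1 last1 {path1 path12 last12 pe rep} => [[E _]|a p1 E]; first by rewrite E eqxx in uv.
  by apply/mapP; exists (u, Z) => //; rewrite E /= mem_last.
case: (lastP (p1 ++ p2)) up path12 last12 pe rep => // p t up path12.
rewrite last_rcons => E; subst t => /= pe rep.
rewrite belast_rcons /= map_rcons rev_rcons /= in pe rep.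
(* The closed walk replays X to X, and seen elements do not depend on the initial set. *)
have g : good (v :: rev (map fst p)).
  by move=> x Y Hx; rewrite [X in RHS]rep; apply: replay_in.
apply: (good_found (q := rev (map fst p))) => //.
  by move: pe; rewrite rev_cons rcons_path => /andP[].
by move: up; rewrite map_rcons mem_rcons inE => /orP[/eqP->|]; rewrite inE ?eqxx // mem_rev => ->; rewrite orbT.
Qed.

End SinkComponent.

(** * Search with two flags *)

Section Search.

(* Vertices [u < n] send flag [true] along their arcs, the others flag
   [false]; a vertex is reached once it carries both flags. *)
Variables (N n : nat) (adj : nat -> seq nat) (init : bool -> nat -> bool).
Hypothesis adj_lt : forall u w, u < N -> w \in adj u -> w < N.

Inductive flagged : bool -> nat -> Prop :=
| flagged_init b z : init b z -> flagged b z
| flagged_arc u z : u < N -> flagged true u -> flagged false u -> z \in adj u ->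
    flagged (u < n) z.

(** [ord] is the queue including its [h] taken vertices, [l] the pending targets, [b] the flag they
    receive. The last clause says that an arc of a taken vertex has been followed or is pending. *)
Definition search_inv (F : bool -> nat -> bool) (ord : seq nat) h (l : seq nat) b :=
  [/\ uniq ord /\ h <= size ord,
      forall z, (z \in ord) = [&& z < N, F true z & F false z],
      forall c z, z < N -> F c z -> flagged c z,
      forall c z, z < N -> init c z -> F c z
    & (forall u z, u \in take h ord -> z \in adj u ->
         F (u < n) z \/ ((u < n) = b /\ z \in l)) /\
      (forall z, z \in l -> exists2 u, u \in take h ord & (u < n) = b /\ z \in adj u)].

Lemma search_init F ord b : uniq ord ->
  (forall c z, z < N -> F c z = init c z) ->
  (forall z, (z \in ord) = [&& z < N, F true z & F false z]) ->
  search_inv F ord 0 [::] b.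
Proof.
move=> uo HF Ho; split; rewrite ?take0 //.
  by move=> c z ltz; rewrite HF //; apply: flagged_init.
by move=> c z ltz; rewrite HF.
Qed.

(** [w] joins the queue exactly when this arc supplies its missing flag, so it joins only once. *)
Lemma search_arc F F' ord h w l b :
  search_inv F ord h (w :: l) b ->
  (forall c z, z < N -> F' c z = F c z || ((c == b) && (z == w))) ->
  search_inv F' (if ~~ F b w && F (~~ b) w then rcons ord w else ord) h l b /\ w < N.
Proof.
move=> [[uo leh] Ho snd ini [cmp cur]] HF.
have [u0 u0o [u0b wu0]] := cur w (mem_head _ _).
have u0r : [&& u0 < N, F true u0 & F false u0] by rewrite -Ho (mem_take u0o).
have ltw : w < N by case/and3P: u0r => /adj_lt ltw _ _; apply: ltw.
have mono c z : z < N -> F c z -> F' c z by move=> ltz; rewrite HF // => ->.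
set ord' := if _ then _ else _.
have Ew : (w \in ord) = F true w && F false w by rewrite Ho ltw.
have tk : take h ord' = take h ord.
  rewrite /ord'; case: ifP => // _; rewrite -cats1 take_cat.
  by case: ltnP => // ge; rewrite (eqP (_ : h - size ord == 0)) ?take0 ?cats0 ?take_oversize // subn_eq0.
split=> //; split; rewrite ?tk.
- rewrite /ord'; case: ifP => // /andP[nF _]; rewrite rcons_uniq uo size_rcons Ew.
  by split; [case: b nF {cur cmp tk ord' HF u0b} => /negbTE->; rewrite ?andbF | apply: leqW].
- move=> z; have -> : (z \in ord') = (z \in ord) || [&& z == w, ~~ F b w & F (~~ b) w].
    rewrite /ord'; case: (~~ F b w && F (~~ b) w); rewrite ?andbT ?andbF ?orbF //.
    by rewrite mem_rcons inE orbC.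
  rewrite Ho; case: ltnP => [ltz|lez] /=; last first.
    by case: eqP => //= E; lia.
  rewrite !HF //; case: eqP => [->|_]; rewrite ?andbF ?orbF //=.
  by rewrite /= !andbT; case: (b); case: (F true w); case: (F false w).
- move=> c z ltz; rewrite HF // => /orP[/(snd _ _ ltz) //|/andP[/eqP-> /eqP->]].
  by rewrite -u0b; case/and3P: u0r => *; apply: flagged_arc => //; apply: snd.
- by move=> c z ltz /ini H; apply: mono => //; apply: H.
split=> [u z uo' zu|z zl].
  have ltz : z < N.
    by move: (mem_take uo'); rewrite Ho => /and3P[/adj_lt H _ _]; apply: H.
  case: (cmp u z uo' zu) => [/mono H|[ub]]; first by left; apply: H.
  rewrite inE => /orP[/eqP->|]; last by right.
  by left; rewrite HF // ub !eqxx orbT.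
by apply: cur; rewrite inE zl orbT.
Qed.

Lemma search_pop F ord h b : search_inv F ord h [::] b -> h < size ord ->
  let u := nth 0 ord h in
  search_inv F ord h.+1 (adj u) (u < n) /\ u < N.
Proof.
move=> [[uo leh] Ho snd ini [cmp _]] lth u.
have uin : u \in ord by apply: mem_nth.
have tk : take h.+1 ord = rcons (take h ord) u by rewrite (take_nth 0).
split; last by move: uin; rewrite Ho => /and3P[].
split=> //; split=> [x z|z zu]; rewrite tk.
  rewrite mem_rcons inE => /orP[/eqP-> ?|xo zx]; first by right.
  by case: (cmp x z xo zx) => [|[]]; [left | rewrite in_nil].
by exists u => //; rewrite mem_rcons mem_head.
Qed.

(** With nothing pending, F is closed under the rules of [flagged]. *)
Lemma search_end F ord b z : search_inv F ord (size ord) [::] b -> z < N ->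
  (z \in ord) <-> flagged true z /\ flagged false z.
Proof.
move=> [_ Ho snd ini [cmp _]] ltz.
have H c x : flagged c x -> x < N -> F c x.
  elim=> {c x} [c x /ini H|u x ltu _ IHt _ IHf xu ltx]; first by move=> ltx; apply: H.
  have uo : u \in take (size ord) ord by rewrite take_size Ho ltu IHt ?IHf.
  by case: (cmp u x uo xu) => // -[].
rewrite Ho ltz /=; split=> [/andP[Ft Ff]|[/H Ft /H Ff]]; first by split; apply: snd.
by rewrite Ft ?Ff.
Qed.

(** Every vertex not yet taken prepays its removal from the queue and all its arcs. *)
Definition potential h (ord : seq nat) :=
  \sum_(z <- iota 0 N | z \notin take h ord) (size (adj z)).+1.

Lemma potential_pop h ord : uniq ord -> h < size ord -> nth 0 ord h < N ->
  potential h ord = (size (adj (nth 0 ord h))).+1 + potential h.+1 ord.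
Proof.
move=> uo lth ltu; rewrite /potential; set u := nth 0 ord h.
have tk : take h.+1 ord = rcons (take h ord) u by rewrite (take_nth 0).
have := take_uniq h.+1 uo; rewrite tk rcons_uniq => /andP[unot _].
have uN : u \in iota 0 N by rewrite mem_iota.
rewrite (big_rem u uN) [X in _ = _ + X](big_rem u uN) /= unot mem_rcons mem_head /= add0n.
congr addn; rewrite big_seq_cond [RHS]big_seq_cond; apply: eq_bigl => z.
rewrite mem_rcons inE negb_or mem_rem_uniq ?iota_uniq // inE.
by case: (z != u); rewrite ?andbF.
Qed.

Lemma potential_rcons h ord w : h <= size ord ->
  potential h (rcons ord w) = potential h ord.
Proof.
move=> leh; apply: eq_bigl => z; congr (_ \notin _).
rewrite -cats1 take_cat; case: ltnP => // ge.
by rewrite (eqP (_ : h - size ord == 0)) ?take0 ?cats0 ?take_oversize // subn_eq0.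
Qed.

End Search.

(** Pigeonhole: counting the nodes taken from the queue reveals whether all nodes were visited. *)
Lemma count_below n (s : seq nat) : uniq s ->
  (n <= count (fun z => z < n) s) = all (mem s) (iota 0 n).
Proof.
move=> us; rewrite -size_filter; set s' := filter _ _.
have us' : uniq s' by apply: filter_uniq.
have sub : {subset s' <= iota 0 n} by move=> z; rewrite mem_filter mem_iota => /andP[].
apply/idP/allP => [le z zn|H].
  have le' : size (iota 0 n) <= size s' by rewrite size_iota.
  have [_ E] := uniq_min_size us' sub le'.
  by move: zn; rewrite -E mem_filter => /andP[].
rewrite -[X in X <= _](size_iota 0); apply: uniq_leq_size (iota_uniq _ _) _ => z zn.
by rewrite mem_filter [z \in s](H z zn) andbT; move: zn; rewrite mem_iota.
Qed.

(** * The search program *)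

Notation "c1 ;; c2" := (CSeq c1 c2) (at level 60, right associativity).

(* Registers: 5 = n, 6 = m, 7 = v, 8 = 1, 10 = loop counter, 13 = start of the
   edge list, 14 = its end; during the search 11 and 12 = head and tail of the
   queue, 15 = current arc (0 = none), 16 = nonzero iff this arc leaves a node,
   17 = number of nodes taken from the queue.
   Arrays: 1 = the input at its original offsets, with the pairs {w, n + x_w}
   appended to the edge list; 3 = first arc of each vertex, 5 = next arc and
   2 = target of each arc; 7 and 6 = the two flags; 9 = the queue.  Arrays 4 and
   8 are left unused because [prologue] spills the parameters there. *)
Definition prepare_copy :=
  CSet 8 1 ;; CAdd 1 5 5 ;; CAdd 1 1 5 ;; CSet 17 3 ;; CAdd 13 1 17 ;;
  CAdd 1 13 6 ;; CAdd 14 1 6 ;; CSet 9 nlow ;; CSub 10 14 9.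
Definition copy_cell :=
  CLoad 1 0 9 ;; CStore 1 9 1 ;; CAdd 9 9 8 ;; CSub 10 10 8.
Definition prepare_nodes :=
  CSet 9 0 ;; CAdd 10 5 9 ;; CAdd 15 17 5 ;; CAdd 16 15 5 ;; CAdd 18 14 9.
(** For bits a and b, truncated subtraction tests equality as 1 - ((a - b) + (b - a)). *)
Definition scan_node :=
  CAdd 1 17 9 ;; CLoad 1 1 1 ;; CAdd 3 15 9 ;; CLoad 3 1 3 ;; CAdd 4 16 3 ;; CLoad 4 1 4 ;;
  CSub 11 1 4 ;; CSub 12 4 1 ;; CAdd 11 11 12 ;; CSub 11 8 11 ;; CStore 6 9 11 ;;
  CAdd 11 5 9 ;; CStore 6 11 8 ;;
  CStore 1 18 9 ;; CAdd 18 18 8 ;; CAdd 3 5 3 ;; CStore 1 18 3 ;; CAdd 18 18 8 ;;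
  CAdd 9 9 8 ;; CSub 10 10 8.
Definition prepare_pairs :=
  CAdd 10 5 6 ;; CSet 9 0 ;; CAdd 18 13 9 ;; CSet 9 1.
(** Register 9 is the next arc number; numbering starts at 1 because 0 ends a list. *)
Definition insert_arc u w :=
  CLoad 3 3 u ;; CStore 5 9 3 ;; CStore 2 9 w ;; CStore 3 u 9 ;; CAdd 9 9 8.
Definition insert_pair :=
  CLoad 1 1 18 ;; CAdd 18 18 8 ;; CLoad 2 1 18 ;; CAdd 18 18 8 ;;
  insert_arc 1 2 ;; insert_arc 2 1 ;; CSub 10 10 8.
Definition prepare_search :=
  CStore 7 7 8 ;; CSet 11 0 ;; CSet 12 0 ;; CSet 15 0 ;; CSet 16 0 ;; CSet 17 0 ;;
  CSet 10 1 ;; CLoad 1 6 7 ;; CIf 1 (CStore 9 12 7 ;; CAdd 12 12 8) (CSet 1 0).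
(** One round follows one arc or takes one vertex, which avoids a nested loop; register 10 is a run
    flag here. Setting register 1 or 2 to 0 serves as a skip. *)
Definition search_step :=
  CIf 15
    (CLoad 1 2 15 ;; CLoad 15 5 15 ;;
     CIf 16 (CLoad 2 7 1 ;; CLoad 3 6 1 ;; CStore 7 1 8)
           (CLoad 2 6 1 ;; CLoad 3 7 1 ;; CStore 6 1 8) ;;
     CIf 2 (CSet 2 0) (CIf 3 (CStore 9 12 1 ;; CAdd 12 12 8) (CSet 2 0)))
    (CSub 1 12 11 ;;
     CIf 1 (CLoad 2 9 11 ;; CAdd 11 11 8 ;; CLoad 15 3 2 ;; CSub 16 5 2 ;;
           CIf 16 (CAdd 17 17 8) (CSet 1 0))
          (CSet 10 0)).
Definition decide := CSub 1 5 17 ;; CSub 0 8 1.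

Definition main_cmd :=
  prepare_copy ;; CWhile 10 copy_cell ;; prepare_nodes ;; CWhile 10 scan_node ;;
  prepare_pairs ;; CWhile 10 insert_pair ;; prepare_search ;; CWhile 10 search_step ;;
  decide.

(** * Adjacency lists and their linked representation *)

Definition add_pair (adj : nat -> seq nat) (p : nat * nat) : nat -> seq nat :=
  fun z => let l := if z == p.1 then p.2 :: adj z else adj z in
           if z == p.2 then p.1 :: l else l.

Definition adj_of (ps : seq (nat * nat)) := foldl add_pair (fun=> [::]) ps.

Lemma adj_of_rcons ps p : adj_of (rcons ps p) = add_pair (adj_of ps) p.
Proof. exact: foldl_rcons. Qed.

Lemma mem_adj_of ps z w : (w \in adj_of ps z) = ((z, w) \in ps) || ((w, z) \in ps).
Proof.
elim/last_ind: ps => // ps [a b] IH; rewrite adj_of_rcons /add_pair !mem_rcons !inE /=.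
rewrite ![(_, _) == _]/eq_op /=.
case: (eqVneq z a) => [<-|_]; case: (eqVneq z b) => [<-|_]; rewrite ?inE IH ?andbT ?andbF //=;
  by case: (w == _); case: (_ \in ps); case: (_ \in ps); rewrite ?orbT.
Qed.

Lemma size_adj_of N ps : all (fun p => (p.1 < N) && (p.2 < N)) ps ->
  \sum_(z <- iota 0 N) size (adj_of ps z) = 2 * size ps.
Proof.
elim/last_ind: ps => [_|ps [a b] IH]; first by rewrite big1.
rewrite all_rcons /= => /andP[/andP[lta ltb] /IH E].
have -> : \sum_(z <- iota 0 N) size (adj_of (rcons ps (a, b)) z) =
  \sum_(z <- iota 0 N) (size (adj_of ps z) + (z == a) + (z == b)).
  apply: eq_bigr => z _; rewrite adj_of_rcons /add_pair /=.
  by case: (z == a); case: (z == b) => /=; rewrite ?addn0 ?addn1.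
have one c : c < N -> \sum_(z <- iota 0 N) (z == c : nat) = 1.
  move=> ltc; rewrite (bigD1_seq c) ?mem_iota ?iota_uniq //= eqxx big1 // => z.
  by move/negbTE->.
by rewrite !big_split /= E !one // size_rcons; lia.
Qed.

(** The bound [B] on the arc numbers is a frame condition: writing arcs beyond it preserves the
    list. *)
Fixpoint linked (nx tg : nat -> nat) B p (l : seq nat) : Prop :=
  if l is w :: l' then [/\ 0 < p, p <= B, tg p = w & linked nx tg B (nx p) l'] else p = 0.

Lemma linked_ext nx tg nx' tg' B B' p l :
  (forall q, 0 < q -> q <= B -> nx' q = nx q /\ tg' q = tg q) -> B <= B' ->
  linked nx tg B p l -> linked nx' tg' B' p l.
Proof.
move=> H leB; elim: l p => //= w l IH p [p0 pB <- /IH L].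
by have [E1 E2] := H p p0 pB; rewrite E1 E2; split=> //; apply: leq_trans leB.
Qed.

(** * Block-wise correctness of the search program *)

Section Program.

Variables (n m v S W : nat) (D : nat -> nat).
Variables (kd : nat -> bool) (el : nat -> nat) (inX : nat -> bool) (es : seq (nat * nat)).
Hypothesis n_gt0 : 0 < n.
Hypothesis ltvn : v < n.
Hypothesis eqS : S = 64 * (n + m).
Hypothesis leSW : 20 * S <= W.
Hypothesis D_kd : forall w, w < n -> D (3 + w) = kd w.
Hypothesis D_el : forall w, w < n -> D (3 + n + w) = el w.
Hypothesis el_lt : forall w, w < n -> el w < n.
Hypothesis D_inX : forall x, x < n -> D (3 + n + n + x) = inX x.
Hypothesis size_es : size es = m.
Hypothesis es_lt : all (fun p => (p.1 < n) && (p.2 < n)) es.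
Hypothesis D_es : forall p, p < m ->
  D (3 + 3 * n + 2 * p) = (nth (0, 0) es p).1 /\
  D (3 + 3 * n + 2 * p + 1) = (nth (0, 0) es p).2.

Notation E0 := (3 + 3 * n).
Notation E1 := (3 + 3 * n + 2 * m).

Definition loaded (s : state) :=
  [/\ [/\ reg s 5 = n, reg s 6 = m & reg s 7 = v],
      forall i, 3 <= i < nlow -> arr s 1 i = D i,
      forall i, nlow <= i < S -> arr s 0 i = D i
    & forall i, i < S -> arr s 3 i = 0 /\ arr s 7 i = 0].

Definition consts (s : state) :=
  [/\ reg s 5 = n, reg s 6 = m, reg s 7 = v, reg s 8 = 1 & reg s 13 = E0].

Definition copy_inv k (s : state) :=
  [/\ consts s, reg s 14 = E1 /\ reg s 17 = 3,
      reg s 10 = k /\ k <= E1 - nlow /\ reg s 9 = nlow + (E1 - nlow - k),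
      forall i, 3 <= i < reg s 9 -> arr s 1 i = D i
    & (forall i, nlow <= i < S -> arr s 0 i = D i) /\
      (forall i, i < S -> arr s 3 i = 0 /\ arr s 7 i = 0)].

Lemma prepare_copy_wp s : loaded s -> wp W S prepare_copy (copy_inv (E1 - nlow)) s.
Proof.
move=> [[r5 r6 r7] a1 a0 az]; rewrite /prepare_copy /= /mem_upd /= r5 r6.
do !(split; first lia).
split; rewrite /consts /= ?r5 ?r6 ?r7; [split; lia | lia | lia | | by split].
exact: a1.
Qed.

Lemma copy_cell_wp k s : copy_inv k s -> reg s 10 <> 0 ->
  0 < k /\ wp W S copy_cell (copy_inv k.-1) s.
Proof.
move=> [[r5 r6 r7 r8 r13] [r14 r17] [r10 [lek r9]] a1 [a0 az]] nz.
split; first lia.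
rewrite /copy_cell /= /mem_upd /arr_upd /= /valid /copy_inv /consts /=.
rewrite r8 r10 in nz *; rewrite r9.
do !(split; try lia).
- move=> i lti; case: eqP => [->|ne]; first by rewrite a0 //; lia.
  by apply: a1; rewrite r9; lia.
- by move=> i lti; apply: a0.
- by case: (az i); lia.
- by case: (az i); lia.
Qed.


Definition init c z := if c then z == v else (n <= z) || (kd z == inX (el z)).

Definition scan_inv k (s : state) :=
  [/\ consts s, [/\ reg s 14 = E1, reg s 17 = 3, reg s 15 = 3 + n & reg s 16 = 3 + n + n],
      [/\ reg s 10 = k, k <= n, reg s 9 = n - k & reg s 18 = E1 + 2 * (n - k)],
      [/\ forall i, 3 <= i < E1 -> arr s 1 i = D i,
          forall w, w < n - k -> arr s 1 (E1 + 2 * w) = w &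
          forall w, w < n - k -> arr s 1 (E1 + 2 * w + 1) = n + el w]
    & [/\ forall w, w < n - k -> arr s 6 w = init false w,
          forall w, w < n - k -> arr s 6 (n + w) = 1
        & forall i, i < S -> arr s 3 i = 0 /\ arr s 7 i = 0]].

(** These rules take the new value in a chosen form, which keeps the symbolic registers small. *)
Lemma wp_set r k c Q R A : k <= W -> wp W S c Q (State (mem_upd R r k) A) ->
  wp W S (CSet r k ;; c) Q (State R A).
Proof. by []. Qed.

Lemma wp_add x r i j c Q R A : R i + R j = x -> x <= W ->
  wp W S c Q (State (mem_upd R r x) A) -> wp W S (CAdd r i j ;; c) Q (State R A).
Proof. by move=> <-. Qed.

Lemma wp_sub x r i j c Q R A : R i - R j = x ->
  wp W S c Q (State (mem_upd R r x) A) -> wp W S (CSub r i j ;; c) Q (State R A).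
Proof. by move=> <-. Qed.

Lemma wp_load y x r a i c Q R A : R i = y -> y < S -> nlow <= a * S + y -> A a y = x ->
  wp W S c Q (State (mem_upd R r x) A) -> wp W S (CLoad r a i ;; c) Q (State R A).
Proof. by move=> <- ? ? <-. Qed.

Lemma wp_store y x r a i c Q R A : R i = y -> R r = x -> y < S -> nlow <= a * S + y ->
  wp W S c Q (State R (arr_upd A a y x)) -> wp W S (CStore a i r ;; c) Q (State R A).
Proof. by move=> <- <-. Qed.

Ltac look := rewrite /mem_upd /=; lia.
Ltac wp_set := apply: wp_set; [lia |].
Ltac wp_add x := apply: (wp_add (x := x)); [look | lia |].
Ltac wp_sub x := apply: (wp_sub (x := x)); [look |].
Ltac wp_load y x := apply: (wp_load (y := y) (x := x)); [look | lia | lia | |].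
Ltac wp_store y x := apply: (wp_store (y := y) (x := x)); [look | look | lia | lia |].

Lemma prepare_nodes_wp s : copy_inv 0 s -> wp W S prepare_nodes (scan_inv n) s.
Proof.
move=> [[r5 r6 r7 r8 r13] [r14 r17] [r10 [lek r9]] a1 [a0 az]].
rewrite /prepare_nodes /= /mem_upd /= /scan_inv /consts /= subnn.
do !(split; try lia); try by [].
- by move=> i lti; apply: a1; rewrite r9; lia.
- by case: (az i); lia.
- by case: (az i); lia.
Qed.

Lemma scan_node_wp k s : scan_inv k s -> reg s 10 <> 0 ->
  0 < k /\ wp W S scan_node (scan_inv k.-1) s.
Proof.
case: s => R A [[r5 r6 r7 r8 r13] [r14 r17 r15 r16] [r10 lek r9 r18] [a1 a1e a1o] [a6 a6e az]] nz.
cbn [reg arr] in *; split; first lia.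
have [w ew] : exists w, w = n - k by exists (n - k).
rewrite -ew in r9 r18 a1e a1o a6 a6e.
have ltw : w < n by lia.
have ltx := el_lt ltw.
have kd1 : kd w <= 1 by case: kd.
have x1 : inX (el w) <= 1 by case: inX.
rewrite /scan_node.
wp_add (3 + w).
wp_load (3 + w) (kd w : nat); first by rewrite a1 ?D_kd //; lia.
wp_add (3 + n + w).
wp_load (3 + n + w) (el w); first by rewrite a1 ?D_el //; lia.
wp_add (3 + n + n + el w).
wp_load (3 + n + n + el w) (inX (el w) : nat); first by rewrite a1 ?D_inX //; lia.
wp_sub (kd w - inX (el w)).
wp_sub (inX (el w) - kd w).
wp_add (kd w - inX (el w) + (inX (el w) - kd w)).
wp_sub (kd w == inX (el w) : nat).
wp_store w (kd w == inX (el w) : nat).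
wp_add (n + w).
wp_store (n + w) 1.
wp_store (E1 + 2 * w) w.
wp_add (E1 + 2 * w + 1).
wp_add (n + el w).
wp_store (E1 + 2 * w + 1) (n + el w).
wp_add (E1 + 2 * w.+1).
wp_add (w.+1).
rewrite /= /scan_inv /consts.
have -> : n - k.-1 = w.+1 by lia.
split; [split; look | split; look | split; look | split | split]; rewrite /arr_upd /=.
- by move=> i lti; do 2 (case: eqP => [|_]; [lia|]); apply: a1.
- move=> u; rewrite ltnS leq_eqVlt => /orP[/eqP->|ltu].
    by case: eqP => [|_]; [lia|]; rewrite eqxx.
  by do 2 (case: eqP => [|_]; [lia|]); apply: a1e.
- move=> u; rewrite ltnS leq_eqVlt => /orP[/eqP->|ltu]; first by rewrite eqxx.
  by do 2 (case: eqP => [|_]; [lia|]); apply: a1o.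
- move=> u; rewrite ltnS leq_eqVlt => /orP[/eqP->|ltu].
    by case: eqP => [|_]; [lia|]; rewrite eqxx /init leqNgt ltw.
  by do 2 (case: eqP => [|_]; [lia|]); apply: a6.
- move=> u; rewrite ltnS leq_eqVlt => /orP[/eqP->|ltu]; first by rewrite eqxx.
  by do 2 (case: eqP => [|_]; [lia|]); apply: a6e.
- exact: az.
Qed.

Definition pairs := es ++ [seq (w, n + el w) | w <- iota 0 n].

Lemma size_pairs : size pairs = m + n.
Proof. by rewrite size_cat size_map size_iota size_es. Qed.

Lemma pairs_lt : all (fun p => (p.1 < 2 * n) && (p.2 < 2 * n)) pairs.
Proof.
rewrite all_cat; apply/andP; split.
  by apply: sub_all es_lt => p /andP[? ?]; apply/andP; split; lia.
apply/allP=> p /mapP[w]; rewrite mem_iota /= => ltw -> /=.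
by have := el_lt ltw; lia.
Qed.

Definition pairs_inv k (s : state) :=
  let p := m + n - k in
  [/\ consts s,
      [/\ reg s 10 = k, k <= m + n, reg s 9 = 2 * p + 1 & reg s 18 = E0 + 2 * p],
      forall q, q < m + n -> arr s 1 (E0 + 2 * q) = (nth (0, 0) pairs q).1 /\
                             arr s 1 (E0 + 2 * q + 1) = (nth (0, 0) pairs q).2,
      forall z, z < 2 * n ->
        linked (arr s 5) (arr s 2) (2 * p) (arr s 3 z) (adj_of (take p pairs) z)
    & forall z, z < 2 * n -> arr s 6 z = init false z /\ arr s 7 z = 0].

Lemma prepare_pairs_wp s : scan_inv 0 s -> wp W S prepare_pairs (pairs_inv (m + n)) s.
Proof.
case: s => R A [[r5 r6 r7 r8 r13] [r14 r17 r15 r16] [r10 lek r9 r18] [a1 a1e a1o] [a6 a6e az]].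
rewrite subn0 in a1e a1o a6 a6e; cbn [reg arr] in *.
rewrite /prepare_pairs.
wp_add (m + n).
wp_set.
wp_add (3 + 3 * n).
rewrite /= /pairs_inv /consts /= subnn take0.
split; first lia.
split; [split; look | split; look | | |].
- move=> q ltq; have sz : size [seq (w, n + el w) | w <- iota 0 n] = n.
    by rewrite size_map size_iota.
  rewrite /pairs nth_cat size_es; case: ltnP => leq.
    by have [<- <-] := D_es leq; rewrite !a1 //; lia.
  have lt' : q - m < n by lia.
  rewrite (nth_map 0) ?size_iota // nth_iota // add0n /= -a1o // -[q - m in RHS]a1e //.
  by split; congr (A 1 _); lia.
- by move=> z ltz; have [|-> //] := az z; lia.
- move=> z ltz; split; last by have [] := az z; lia.
  case/orP: (leqVgt n z) => [lez|]; last exact: a6.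
  have lt' : z - n < n by lia.
  by have := a6e _ lt'; rewrite subnKC // /init lez.
Qed.

Lemma insert_arc_wp ru rw u w q c Q R A :
 ru \notin [:: 3; 9] -> rw \notin [:: 3; 9] ->
  R ru = u -> R rw = w -> R 9 = q -> R 8 = 1 -> u < S -> q < S ->
  wp W S c Q (State (mem_upd (mem_upd R 3 (A 3 u)) 9 (q + 1))
                    (arr_upd (arr_upd (arr_upd A 5 q (A 3 u)) 2 q w) 3 u q)) ->
  wp W S (insert_arc ru rw ;; c) Q (State R A).
Proof.
rewrite !inE !negb_or => /andP[/negbTE u3 /negbTE u9] /andP[/negbTE w3 _] Ru Rw R9 R8 ltu ltq H.
change (wp W S (insert_arc ru rw) (wp W S c Q) (State R A)); rewrite /insert_arc.
apply: (wp_load (y := u) (x := A 3 u)) => //; first lia.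
apply: (wp_store (y := q) (x := A 3 u)) => //; first lia.
apply: (wp_store (y := q) (x := w)) => //; [by rewrite /mem_upd w3 | lia |].
apply: (wp_store (y := u) (x := q)) => //; [by rewrite /mem_upd u3 | lia |].
rewrite /= /mem_upd /= R9 R8; split; first lia.
exact: H.
Qed.

Lemma insert_pair_wp k s : pairs_inv k s -> reg s 10 <> 0 ->
  0 < k /\ wp W S insert_pair (pairs_inv k.-1) s.
Proof.
case: s => R A [[r5 r6 r7 r8 r13] [r10 lek r9 r18] a1 lnk a67] nz.
cbn [reg arr] in *; split; first lia.
have [p ep'] : exists p, p = m + n - k by exists (m + n - k).
rewrite -ep' in r9 r18 lnk.
have ltp : p < m + n by lia.
have ep : m + n - k.-1 = p.+1 by lia.
have [u [w [E_uw ltu ltw]]] : exists u w,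
    [/\ nth (0, 0) pairs p = (u, w), u < 2 * n & w < 2 * n].
  have : (nth (0, 0) pairs p \in pairs) by rewrite mem_nth ?size_pairs.
  by move=> /(allP pairs_lt); case: nth => u w /= /andP[]; exists u, w.
have [E_u E_w] := a1 _ ltp; rewrite E_uw /= in E_u E_w.
rewrite /insert_pair.
wp_load (3 + 3 * n + 2 * p) u; first exact: E_u.
wp_add (3 + 3 * n + 2 * p + 1).
wp_load (3 + 3 * n + 2 * p + 1) w; first exact: E_w.
wp_add (3 + 3 * n + 2 * p.+1).
apply: (insert_arc_wp (u := u) (w := w) (q := 2 * p + 1));
  [by [] | by [] | look | look | look | look | lia | lia |].
apply: (insert_arc_wp (u := w) (w := u) (q := 2 * p + 1 + 1));
  [by [] | by [] | look | look | look | look | lia | lia |].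
set A'' := arr_upd _ 3 w _.
have A1 q : A'' 1 q = A 1 q by rewrite /A'' /arr_upd /=.
have A6 q : A'' 6 q = A 6 q by rewrite /A'' /arr_upd /=.
have A7 q : A'' 7 q = A 7 q by rewrite /A'' /arr_upd /=.
have A3 z : A'' 3 z = if z == w then 2 * p + 1 + 1 else if z == u then 2 * p + 1 else A 3 z.
  by rewrite /A'' /arr_upd /=.
(* If both ends coincide, the second arc points to the first one. *)
have A5 q : A'' 5 q = if q == 2 * p + 1 + 1 then if w == u then 2 * p + 1 else A 3 w
                      else if q == 2 * p + 1 then A 3 u else A 5 q.
  by rewrite /A'' /arr_upd /=.
have A2 q : A'' 2 q = if q == 2 * p + 1 + 1 then u
                      else if q == 2 * p + 1 then w else A 2 q.
  by rewrite /A'' /arr_upd /=.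
move: A'' A1 A6 A7 A3 A5 A2 => A'' A1 A6 A7 A3 A5 A2.
have L z : z < 2 * n ->
    linked (A'' 5) (A'' 2) (2 * p.+1) (A 3 z) (adj_of (take p pairs) z).
  move=> /lnk; apply: linked_ext; last by lia.
  by move=> q q0 leq; rewrite A5 A2; do 2 (case: eqP => [|_]; [lia|]).
have Lu z : z < 2 * n -> linked (A'' 5) (A'' 2) (2 * p.+1)
    (if z == u then 2 * p + 1 else A 3 z)
    (if z == u then w :: adj_of (take p pairs) z else adj_of (take p pairs) z).
  move=> ltz; case: eqP => [->|_]; last exact: L.
  have ne : (2 * p + 1 == 2 * p + 1 + 1) = false by apply/eqP; lia.
  by split; [lia | lia | rewrite A2 ne eqxx | rewrite A5 ne eqxx; apply: L].
rewrite /= /pairs_inv ep (take_nth (0, 0)) ?size_pairs // adj_of_rcons E_uw.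
split; [split; look | split; look | | |].
- by move=> q ltq /=; rewrite !A1; apply: a1.
- move=> z ltz; rewrite /add_pair /= A3; case: (eqVneq z w) => [->|_]; last exact: Lu.
  by split; [lia | lia | rewrite A2 eqxx | rewrite A5 eqxx; apply: Lu].
- by move=> z ltz /=; rewrite A6 A7; apply: a67.
Qed.

Notation adj := (adj_of pairs).
Notation N := (2 * n).

Definition flags (A : nat -> nat -> nat) c z := (if c then A 7 z else A 6 z) != 0.

(** The measure counts the untaken vertices with their arcs, the pending arcs, and one round that
    clears register 10. *)
Definition run_inv k (s : state) := exists ord h l b,
  [/\ [/\ reg s 5 = n, reg s 8 = 1 & search_inv N n adj init (flags (arr s)) ord h l b],
      [/\ reg s 10 <= 1, k = potential N adj h ord + size l + reg s 10,
          reg s 10 = 0 -> l = [::] /\ h = size ord, reg s 11 = h & reg s 12 = size ord],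
      [/\ linked (arr s 5) (arr s 2) (2 * (m + n)) (reg s 15) l,
          l <> [::] -> (reg s 16 != 0) = b
        & reg s 17 = count (fun z => z < n) (take h ord)],
      forall i, i < size ord -> arr s 9 i = nth 0 ord i
    & forall z, z < N -> linked (arr s 5) (arr s 2) (2 * (m + n)) (arr s 3 z) (adj z)].

Lemma adj_pairs_lt u w : u < N -> w \in adj u -> w < N.
Proof. by move=> _; rewrite mem_adj_of => /orP[] /(allP pairs_lt) /andP[]. Qed.

(** 2n removals and two arcs for each of the m + n pairs. *)
Lemma potential0 ord : potential N adj 0 ord = 4 * n + 2 * m.
Proof.
rewrite /potential take0 (eq_bigl xpredT) //.
under eq_bigr => z _ do rewrite -addn1.
rewrite big_split /= size_adj_of ?pairs_lt // size_pairs sum1_size size_iota; lia.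
Qed.

Lemma prepare_search_wp s : pairs_inv 0 s ->
  wp W S prepare_search (run_inv (4 * n + 2 * m + 1)) s.
Proof.
case: s => R A [[r5 r6 r7 r8 r13] [r10 lek r9 r18] a1 lnk a67].
cbn [reg arr] in *.
rewrite subn0 -size_pairs take_size in lnk.
have ltvN : v < N by lia.
have inv A' b : (forall z, z < N -> A' 6 z = A 6 z /\ A' 7 z = (z == v)) ->
    search_inv N n adj init (flags A') (if A 6 v == 0 then [::] else [:: v]) 0 [::] b.
  move=> HA; have HF c z : z < N -> flags A' c z = init c z.
    by move=> ltz; rewrite /flags; have [E6 E7] := HA z ltz;
      case: c; rewrite ?E6 ?E7 ?(a67 z ltz).1 eqb0 negbK.
  apply: search_init => //; first by case: ifP.
  move=> z; case: ltnP => ltz /=; last first.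
    by case: ifP => // _; rewrite mem_seq1; apply/eqP; lia.
  rewrite !HF // (a67 v ltvN).1 /init eqb0.
  by case: ifP => Hv; rewrite ?mem_seq1; case: eqP => // ->; move: Hv; case: (_ || _).
have lnk' z : z < N -> linked (A 5) (A 2) (2 * (m + n)) (A 3 z) (adj z).
  by rewrite -size_pairs; apply: lnk.
rewrite /prepare_search.
wp_store v 1.
do 6 wp_set.
wp_load v (A 6 v); first by [].
set A1 := arr_upd A 7 v 1.
have HA1 z : z < N -> A1 6 z = A 6 z /\ A1 7 z = (z == v).
  move=> ltz; split=> //; rewrite /A1 /arr_upd /=; case: eqP => // _.
  by have [] := a67 z ltz.
split; rewrite [reg _ _]/= /mem_upd /= => Hv.
  split; first by split; lia.
  split; first lia.
  rewrite r7 r8; have := inv (arr_upd A1 9 0 v) false; rewrite (negbTE (introN eqP Hv)) => inv1.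
  exists [:: v], 0, [::], false; rewrite /mem_upd; split; [split| split | split | |] => //=.
  - by apply: inv1 => z ltz; apply: HA1.
  - by rewrite potential0; lia.
  - by case=> // _; rewrite /arr_upd.
split; first lia.
have := inv A1 false; rewrite Hv eqxx => inv1.
exists [::], 0, [::], false; rewrite /mem_upd; split; [split| split | split | |] => //=.
- exact: inv1.
- by rewrite potential0; lia.
Qed.

Lemma search_inv_size F ord h l b :
  search_inv N n adj init F ord h l b -> size ord <= N.
Proof.
move=> [[uo _] Ho _ _ _]; rewrite -[X in _ <= X](size_iota 0).
apply: uniq_leq_size => // z; rewrite Ho => /and3P[ltz _ _].
by rewrite mem_iota.
Qed.

Lemma search_step_wp k s : run_inv k s -> reg s 10 <> 0 ->
  0 < k /\ wp W S search_step (run_inv k.-1) s.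
Proof.
case: s => R A [ord [h [l [b [[r5 r8 inv] [r10 ek stop r11 r12] [lnk ty r17] a9 adjl]]]]] nz.
cbn [reg arr] in *; split; first lia.
have R10 : R 10 = 1 by lia.
have leN := search_inv_size inv.
have leh : h <= size ord by case: inv => [[]].
split => [r15|r15].
  change (reg (State R A) 15) with (R 15) in r15.
  case: l => [|w l] in inv ek stop lnk ty; first by [].
  have {ty} ty : (R 16 != 0) = b by apply: ty.
  have [p0 pB tw lnk'] := lnk.
  (* Arcs from nodes and from elements share this part: [R' 2] is the old value of the flag just
     set, [R' 3] the other flag of [w]. *)
  have tail R' A' :
      [/\ R' 5 = n, R' 8 = 1, R' 10 = 1, R' 11 = h & R' 12 = size ord] ->
      [/\ R' 1 = w, R' 2 = A (if b then 7 else 6) w, R' 3 = A (if b then 6 else 7) w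
        & R' 15 = A 5 (R 15)] ->
      R' 16 = R 16 -> R' 17 = R 17 ->
      (forall j z, A' j z = if (j == if b then 7 else 6) && (z == w) then 1 else A j z) ->
      wp W S (CIf 2 (CSet 2 0) (CIf 3 (CStore 9 12 1 ;; CAdd 12 12 8) (CSet 2 0)))
        (run_inv k.-1) (State R' A').
    move=> [q5 q8 q10 q11 q12] [q1 q2 q3 q15] q16 q17 HA'.
    have HF c z : z < N -> flags A' c z = flags A c z || ((c == b) && (z == w)).
      move=> _; rewrite /flags !HA'; case: (z == w); rewrite ?andbF ?orbF //.
      by case: c; case: (b); rewrite ?orbT ?orbF.
    have [inv' ltw] := search_arc adj_pairs_lt inv HF.
    have A'5 q : A' 5 q = A 5 q by rewrite HA'; case: (b).
    have A'2 q : A' 2 q = A 2 q by rewrite HA'; case: (b).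
    have A'3 q : A' 3 q = A 3 q by rewrite HA'; case: (b).
    have A'9 q : A' 9 q = A 9 q by rewrite HA'; case: (b).
    have lk p l' : linked (A 5) (A 2) (2 * (m + n)) p l' ->
        linked (A' 5) (A' 2) (2 * (m + n)) p l'.
      by apply: linked_ext.
    have newF : flags A b w = (R' 2 != 0) by rewrite q2 /flags; case: (b).
    have othF : flags A (~~ b) w = (R' 3 != 0) by rewrite q3 /flags; case: (b).
    rewrite newF othF in inv'.
    have stay R'' : ~~ ((R' 2 == 0) && (R' 3 != 0)) -> (forall i, i <> 2 -> R'' i = R' i) ->
        run_inv k.-1 (State R'' A').
      move=> no HR; rewrite negbK (negbTE no) in inv'.
      exists ord, h, l, b; cbn [reg arr]; rewrite !HR //; split; [by [] | split | split | |] => //.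
      - by lia.
      - by rewrite ek /= q10 R10; lia.
      - by rewrite q10.
      - by rewrite q15; apply: lk.
      - by rewrite q16.
      - by rewrite q17.
      - by move=> i lti; rewrite A'9; apply: a9.
      - by move=> z ltz; rewrite A'3; apply: lk; apply: adjl.
    split=> [t2|t2].
      split=> //; apply: stay => [|i ne]; first by rewrite negb_and; apply/orP; left; apply/eqP.
      by rewrite /mem_upd /=; case: eqP.
    change (R' 2 = 0) in t2; rewrite t2 eqxx /= in stay inv'.
    split=> [t3|t3]; last first.
      change (R' 3 = 0) in t3.
      split=> //; apply: stay => [|i ne]; first by rewrite t3.
      by rewrite /mem_upd /=; case: eqP.
    change (R' 3 <> 0) in t3; rewrite (introN eqP t3) in inv'.
    split; first by split; cbn [reg]; rewrite q12; lia.
    split; first by cbn [reg]; lia.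
    cbn [reg arr]; rewrite q12 q8 q1.
    exists (rcons ord w), h, l, b; cbn [reg arr]; rewrite /mem_upd [12 == 12]/=.
    split; [split | split | split | |] => //.
    - by rewrite /= q10.
    - by rewrite potential_rcons // ek /= q10 R10; lia.
    - by rewrite /= q10.
    - by rewrite size_rcons /= addn1.
    - by rewrite /= q15; apply: lk.
    - by rewrite /= q16.
    - rewrite /= q17 r17; congr count; rewrite -cats1 take_cat; case: ltnP => // ge.
      by rewrite (eqP (_ : h - size ord == 0)) ?subn_eq0 // take0 cats0 take_oversize.
    - move=> i; rewrite size_rcons ltnS nth_rcons /arr_upd /= => lei.
      case: (eqVneq i (size ord)) => [->|ne]; first by rewrite ltnn.
      by rewrite ltn_neqAle ne lei A'9 a9 // ltn_neqAle ne lei.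
    - by move=> z ltz; rewrite /arr_upd /= A'3; apply: lk; apply: adjl.
  have ltw : w < N.
    by have [] := search_arc (F' := fun c z => flags A c z || ((c == b) && (z == w))) adj_pairs_lt inv.
  have pS : R 15 < S by lia.
  wp_load (R 15) w; first exact: tw.
  wp_load (R 15) (A 5 (R 15)); first by [].
  split=> [t|t]; [have {}t : R 16 <> 0 := t | have {}t : R 16 = 0 := t].
    have eb : b = true by rewrite -ty; apply/eqP.
    wp_load w (A 7 w); first by [].
    wp_load w (A 6 w); first by [].
    split; first by split; rewrite [reg _ _]/= /mem_upd /=; lia.
    apply: tail; rewrite ?eb; [split; look | split; look | by [] | by [] |].
    by move=> j z; rewrite /= /arr_upd /mem_upd /= r8.
  have eb : b = false by rewrite -ty t.
  wp_load w (A 6 w); first by [].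
  wp_load w (A 7 w); first by [].
  split; first by split; rewrite [reg _ _]/= /mem_upd /=; lia.
  apply: tail; rewrite ?eb; [split; look | split; look | by [] | by [] |].
  by move=> j z; rewrite /= /arr_upd /mem_upd /= r8.
(* No arc is pending: a vertex is taken, or the empty queue ends the loop. *)
change (R 15 = 0) in r15.
have el0 : l = [::] by case: (l) lnk => // w l' []; rewrite r15.
rewrite {}el0 in inv ek stop lnk ty.
wp_sub (size ord - h).
split=> [t|t]; [have {}t : size ord - h <> 0 := t | have {}t : size ord - h = 0 := t]; last first.
  split; first lia.
  exists ord, h, [::], b; cbn [reg arr]; rewrite /mem_upd /=.
  split; [split | split | split | |]  => //.
    by rewrite ek R10 /=; lia.
  by move=> _; split=> //; lia.
have lth : h < size ord by lia.
have [inv' ltu] := search_pop inv lth.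
have pot := potential_pop adj (let: And5 (conj uo _) _ _ _ _ := inv in uo) lth ltu.
set u := nth 0 ord h in inv' ltu pot.
wp_load h u; first exact: a9.
wp_add h.+1.
wp_load u (A 3 u); first by [].
wp_sub (n - u).
have tk : take h.+1 ord = rcons (take h ord) u by rewrite (take_nth 0).
have fin R'' : (forall i, i <> 1 -> i <> 17 -> R'' i =
      mem_upd (mem_upd (mem_upd (mem_upd (mem_upd R 1 (size ord - h)) 2 u) 11 h.+1)
              15 (A 3 u)) 16 (n - u) i) ->
    R'' 17 = R 17 + (u < n) -> run_inv k.-1 (State R'' A).
  move=> HR R17; exists ord, h.+1, (adj u), (u < n); cbn [reg arr].
  rewrite R17 !HR // /mem_upd /=.
  split; [split | split | split | |] => //; try lia.
  - by rewrite ek pot R10 /=; lia.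
  - by apply: adjl.
  - by rewrite r17 tk -cats1 count_cat /= addn0.
split=> [t'|t']; [have {}t' : n - u <> 0 := t' | have {}t' : n - u = 0 := t'].
  have le17 : R 17 <= N.
    by rewrite r17; apply: leq_trans (count_size _ _) _; rewrite size_take lth; lia.
  split; first by rewrite ![reg _ _]/= /mem_upd /=; lia.
  apply: fin => [i n1 n17|]; rewrite /mem_upd /=; first by case: (i =P 17).
  by rewrite r8; lia.
split; first lia.
apply: fin => [i n1 n17|]; rewrite /mem_upd /=; first by case: (i =P 1).
by lia.
Qed.

Lemma decide_wp k s : run_inv k s -> reg s 10 = 0 ->
  wp W S decide (fun s' => reg s' 0 == 1 <->
    forall w, w < n -> flagged N n adj init true w /\ flagged N n adj init false w) s.
Proof.
move=> [ord [h [l [b [[r5 r8 inv] [_ _ stop _ _] [_ _ r17] _ _]]]]] /stop[El Eh].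
rewrite {}El {}Eh in inv r17; rewrite take_size in r17.
rewrite /decide /= /mem_upd /= r5 r8 r17.
have uo : uniq ord by case: inv => [[]].
have -> : (1 - (n - count (fun z => z < n) ord) == 1) = (n <= count (fun z => z < n) ord).
  by apply/eqP/idP; lia.
rewrite (count_below _ uo); split=> [/allP H w ltw|H].
  apply/(search_end inv); first by lia.
  by apply: H; rewrite mem_iota.
apply/allP=> w; rewrite mem_iota => /= ltw; apply/(search_end inv); first by lia.
exact: H.
Qed.

Definition accepts (s : state) := reg s 0 == 1 <->
  forall w, w < n -> flagged N n adj init true w /\ flagged N n adj init false w.

(** The loops make at most 3n + 2m, n, n + m and 4n + 2m + 1 rounds of constant cost; 500 is a
    generous factor. *)
Lemma main_triple s : loaded s ->
  triple W S main_cmd s (500 * (n + m) + 500) accepts.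
Proof.
have leSW' : narrs * S <= W by lia.
have leS : nlow <= S by lia.
have blk c Q s' : wp W S c Q s' -> wf c -> triple W S c s' (cost c) Q.
  by move=> H wfc; apply: triple_wp.
have whl c I Q k s' : I k s' ->
    (forall k' s', I k' s' -> reg s' 10 <> 0 -> 0 < k' /\ wp W S c (I k'.-1) s') ->
    (forall k' s', I k' s' -> reg s' 10 = 0 -> Q s') ->
    wf c -> triple W S (CWhile 10 c) s' (k * (cost c + 3) + 1) Q.
  by move=> HI step exit_ wfc; apply: (@triple_while _ _ leSW' leS 10 c I Q k s').
move=> H; rewrite /main_cmd.
apply: triple_le; last first.
  apply: triple_seq; first exact: blk (prepare_copy_wp H) isT.
  move=> s1 {}H; apply: (triple_seq (Q1 := copy_inv 0)).
    apply: whl H copy_cell_wp _ isT => k s' H'.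
    by case: (H') => _ _ [Ek _] _ _ E; rewrite -[0]E Ek.
  move=> s2 {}H; apply: triple_seq; first exact: blk (prepare_nodes_wp H) isT.
  move=> s3 {}H; apply: (triple_seq (Q1 := scan_inv 0)).
    apply: whl H scan_node_wp _ isT => k s' H'.
    by case: (H') => _ _ [Ek _ _ _] _ _ E; rewrite -[0]E Ek.
  move=> s4 {}H; apply: triple_seq; first exact: blk (prepare_pairs_wp H) isT.
  move=> s5 {}H; apply: (triple_seq (Q1 := pairs_inv 0)).
    apply: whl H insert_pair_wp _ isT => k s' H'.
    by case: (H') => _ [Ek _ _ _] _ _ _ E; rewrite -[0]E Ek.
  move=> s6 {}H; apply: triple_seq; first exact: blk (prepare_search_wp H) isT.
  move=> s7 {}H; apply: (triple_seq (Q1 := fun s => exists2 k, run_inv k s & reg s 10 = 0)).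
    by apply: whl H search_step_wp _ isT => k s' H' E; exists k.
  by move=> s8 [k {}H E]; exact: blk (decide_wp H E) isT.
rewrite [cost prepare_copy]/= [cost copy_cell]/= [cost prepare_nodes]/= [cost scan_node]/=.
rewrite [cost prepare_pairs]/= [cost insert_pair]/= [cost prepare_search]/=.
rewrite [cost search_step]/= [cost decide]/=.
all: lia.
Qed.

End Program.

(** * Relocation of the input *)

Definition rep k (ins : nat -> seq instr) := flatten [seq ins i | i <- iota 0 k].

(* At the start only the cells 0, 1, 2 have known contents and all others hold
   input, so addresses must be formed without a free cell: cell 1 becomes
   m + 128 (n + m), which still determines m, and v is stored there.  The other
   spills go to 4S and 8S, where S = 64 (n + m), and the input cells below
   [nlow] to S + 3, S + 4, etc. *)
Definition prologue : seq instr :=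
  [:: IAdd 0 0 1] ++ rep 128 (fun=> [:: IAdd 1 1 0]) ++ [:: IStore 1 2; ISub 2 1 0] ++
  rep 127 (fun=> [:: ISub 2 2 0]) ++
  [:: ISub 0 0 2; ISub 1 1 2; IAdd 1 1 1; IStore 1 0; IAdd 0 1 1] ++
  [:: IStore 0 2; ILoad 0 1; IAdd 0 0 2] ++ rep 6 (fun=> [:: IAdd 0 0 0]) ++
  [:: ISet 2 2; IAdd 0 0 2; ISet 2 1] ++
  rep (nlow - 3) (fun i => [:: IAdd 0 0 2; IStore 0 (3 + i)]) ++
  [:: ISet 3 (nlow - 1); ISub 3 0 3; ISet nregs 0] ++
  rep narrs.-1 (fun j => [:: IAdd (nregs + j.+1) (nregs + j) 3]) ++
  [:: ILoad 5 (nregs + 4); ILoad 6 (nregs + 8); IAdd 4 (nregs + 2) 6; ILoad 7 4].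

Lemma wpl_seq W l1 l2 (Q1 Q2 : memory -> Prop) M :
  wpl W l1 Q1 M -> (forall M', Q1 M' -> wpl W l2 Q2 M') -> wpl W (l1 ++ l2) Q2 M.
Proof. by move=> H1 H2; apply/wpl_cat; apply: wpl_mono H1. Qed.

Section Prologue.

Variables (n m v W : nat) (D : memory).
Hypothesis n_gt0 : 0 < n.
Hypothesis ltvn : v < n.
Notation s := (n + m).
Notation S := (64 * (n + m)).
Hypothesis leSW : 20 * S <= W.
Hypothesis D0 : D 0 = n.
Hypothesis D1 : D 1 = m.
Hypothesis D2 : D 2 = v.
Hypothesis D_out : forall a, S <= a -> D a = 0.

Definition low3 a b c (G M : memory) :=
  [/\ M 0 = a, M 1 = b, M 2 = c & forall x, 3 <= x -> M x = G x].

Definition loaded_mem (M : memory) :=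
  [/\ [/\ M 5 = n, M 6 = m & M 7 = v],
      forall j, j < narrs -> M (nregs + j) = j * S,
      forall i, 3 <= i < nlow -> M (S + i) = D i,
      forall i, nlow <= i < S -> M i = D i
    & forall i, i < S -> M (3 * S + i) = 0 /\ M (7 * S + i) = 0].

Lemma prologue_wpl M : M =1 D -> wpl W prologue loaded_mem M.
Proof.
move=> MD.
refine (wpl_seq (Q1 := low3 s m v D) _ _).
  rewrite /= !MD D0 D1; split; first lia.
  rewrite /low3 /mem_upd /= !MD D1 D2; split=> // x lex.
  by case: eqP => [|_]; [lia | apply: MD].
(* 128 s = 2 S, so the address in cell 1 lies beyond the input. *)
move=> {MD}M HM; refine (wpl_seq (Q1 := low3 s (m + 128 * s) v D) _ _).
  refine (wpl_iter (I := fun i => low3 s (m + i * s) v D) _ _); last by rewrite mul0n addn0.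
  move=> i {HM}M lti [H0 H1 H2 HG] /=; rewrite /low3 /mem_upd /= H0 H1 H2.
  have := leq_mul2r s i.+1 128; rewrite lti orbT mulSn => le.
  split; first lia.
  split=> //; first by lia.
  by move=> x lex; case: eqP => [|_]; [lia | apply: HG].
move=> {HM}M HM.
pose G1 x := if x == 2 * S + m then v else D x.
refine (wpl_seq (Q1 := low3 s (m + 128 * s) (m + 127 * s) G1) _ _).
  case: HM => H0 H1 H2 HG; rewrite /= /low3 /mem_upd /= H0 H1 H2 /G1.
  have -> : m + 128 * s = 2 * S + m by lia.
  have ne j : j < 3 -> (j == 2 * S + m) = false by move=> ltj; apply/eqP; lia.
  rewrite !ne //; split=> //; first by lia.
  by move=> x lex; case: eqP => [|_]; [lia | case: eqP => // _; apply: HG].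
move=> {HM}M HM; refine (wpl_seq (Q1 := low3 s (2 * S + m) m G1) _ _).
  pose I i := low3 s (2 * S + m) (m + (127 - i) * s) G1.
  have <- : I 127 = low3 s (2 * S + m) m G1 by rewrite /I subnn mul0n addn0.
  refine (wpl_iter _ _); last first.
    by case: HM => H0 H1 H2 HG; split=> //; lia.
  move=> i {HM}M lti; rewrite /I; have [t [-> ->]] : exists t, 127 - i = t.+1 /\ 127 - i.+1 = t.
    by exists (127 - i.+1); lia.
  move=> [H0 H1 H2 HG] /=; rewrite /low3 /mem_upd /= H0 H1 H2.
  split=> //; first by rewrite mulSn; lia.
  by move=> x lex; case: eqP => [|_]; [lia | apply: HG].
move=> {HM}M HM.
(* Once m is recovered, n = s - m and 2 S is cell 1 minus m; doubling gives the addresses 4 S and 8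
   S. *)
pose G2 x := if x == 4 * S then n else G1 x.
refine (wpl_seq (Q1 := low3 (8 * S) (4 * S) m G2) _ _).
  case: HM => H0 H1 H2 HG; rewrite /= /low3 /mem_upd /= H0 H1 H2.
  have -> : 2 * S + m - m + (2 * S + m - m) = 4 * S by lia.
  have -> : n + m - m = n by lia.
  have ne j : j < 3 -> (j == 4 * S) = false by move=> ltj; apply/eqP; lia.
  rewrite !ne //=; split; first lia; split; first lia; split=> //; try lia.
  move=> x lex; rewrite /G2; case: eqP => [|_]; [lia|].
  by case: eqP => // _; case: eqP => [|_]; [lia | apply: HG].
move=> {HM}M HM.
pose G3 x := if x == 8 * S then m else G2 x.
refine (wpl_seq (Q1 := low3 s (4 * S) m G3) _ _).
  case: HM => H0 H1 H2 HG; rewrite /= /low3 /mem_upd /= H0 H1 H2.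
  have ne j : j < 3 -> (j == 8 * S) = false by move=> ltj; apply/eqP; lia.
  have ne4 : (4 * S == 8 * S) = false by apply/eqP; lia.
  rewrite (ne 1 isT) (ne 2 isT); change (if false then m else 4 * S) with (4 * S).
  rewrite ne4 HG; last by lia.
  have -> : G2 (4 * S) = n by rewrite /G2 eqxx.
  split; first lia; split=> // x lex; rewrite /G3.
  by case: eqP => [|_]; [lia|]; case: eqP => // _; apply: HG.
move=> {HM}M HM.
refine (wpl_seq (Q1 := low3 S (4 * S) m G3) _ _).
  (* Six doublings turn s into S. *)
  pose I i := low3 (s * 2 ^ i) (4 * S) m G3.
  have <- : I 6 = low3 S (4 * S) m G3 by rewrite /I mulnC.
  refine (wpl_iter _ _); last by rewrite /I muln1.
  move=> i {HM}M lti [H0 H1 H2 HG] /=; rewrite /I /low3 /mem_upd /= H0 H1 H2.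
  have le : s * 2 ^ i <= s * 2 ^ 6 by rewrite leq_mul2l leq_exp2l // ltnW ?orbT.
  split; first by move: le; rewrite (_ : 2 ^ 6 = 64) //; lia.
  split=> //; first by rewrite expnS mulnCA; lia.
  by move=> x lex; case: eqP => [|_]; [lia | apply: HG].
move=> {HM}M HM.
refine (wpl_seq (Q1 := low3 (S + 2) (4 * S) 1 G3) _ _).
  case: HM => H0 H1 H2 HG; rewrite /= /low3 /mem_upd /= H0 H1.
  do 3 (split; first lia); split=> // x lex.
  by do 2 (case: eqP => [|_]; [lia|]); apply: HG.
move=> {HM}M HM.
pose H i x := if (S + 3 <= x) && (x < S + 3 + i) then D (x - S) else G3 x.
refine (wpl_seq (Q1 := low3 (S + (nlow - 1)) (4 * S) 1 (H (nlow - 3))) _ _).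
  refine (wpl_iter (I := fun i => low3 (S + (2 + i)) (4 * S) 1 (H i)) _ _); last first.
    case: HM => H0 H1 H2 HG; split=> // x lex; rewrite /H HG //.
    by case: andP => // -[]; lia.
  move=> i {HM}M lti [H0 H1 H2 HG] /=; rewrite /low3 /mem_upd /= H0 H2.
  have ne j : j < 3 -> (j == S + (2 + i) + 1) = false by move=> ltj; apply/eqP; lia.
  rewrite !ne // ?H1 ?H2; split; first lia.
  split=> //; first by lia.
  move=> x lex; case: eqP => [->|nx].
    rewrite HG; last by lia.
    rewrite /H; have -> : (S + 3 <= 3 + i) = false by lia.
    have -> : S + (2 + i) + 1 - S = 3 + i by lia.
    have -> : (S + 3 <= S + (2 + i) + 1) && (S + (2 + i) + 1 < S + 3 + i.+1) by lia.
    by rewrite /= /G3 /G2 /G1; do 3 (case: eqP => [|_]; [lia|]).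
  case: eqP => [|_]; [lia|]; rewrite HG // /H.
  by have -> : (x < S + 3 + i.+1) = (x < S + 3 + i) by lia.
move=> {HM}M HM.
(* The low input cells are saved, so cell 3 is free to hold the stride. *)
pose J M' := [/\ M' 3 = S, M' nregs = 0 & forall x, nlow <= x -> M' x = H (nlow - 3) x].
refine (wpl_seq (Q1 := J) _ _).
  case: HM => H0 H1 H2 HG; rewrite /= /J /mem_upd /= H0.
  do 2 (split; first lia); split; [lia | by [] |].
  by move=> x lex; do 2 (case: eqP => [|_]; [lia|]); apply: HG; lia.
move=> {HM}M HM.
refine (wpl_seq (Q1 := fun M' => [/\ M' 3 = S, forall j, j <= narrs.-1 -> M' (nregs + j) = j * S
    & forall x, nlow <= x -> M' x = H (nlow - 3) x]) _ _).
  refine (wpl_iter (I := fun i M' => [/\ M' 3 = S, forall j, j <= i -> M' (nregs + j) = j * S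
    & forall x, nlow <= x -> M' x = H (nlow - 3) x]) _ _); last first.
    by case: HM => H3 H20 HG; split=> // j; rewrite leqn0 => /eqP->.
  move=> i {HM}M lti [H3 Hb HG] /=; rewrite /mem_upd /= Hb // H3.
  have le : i * S <= 9 * S by rewrite leq_mul2r ltnW ?orbT.
  split; first lia.
  split=> //.
    move=> j lej; rewrite eqn_add2l; case: eqP => [->|ne]; first by rewrite mulSn addnC.
    by apply: Hb; lia.
  by move=> x lex; case: eqP => [|_]; [lia | apply: HG].
move=> {HM}M [H3 Hb HG].
have E4 : H (nlow - 3) (4 * S) = n.
  rewrite /H; have -> : (4 * S < S + 3 + (nlow - 3)) = false by lia.
  by rewrite andbF /G3 /G2 eqxx; case: eqP => //; lia.
have E8 : H (nlow - 3) (8 * S) = m.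
  rewrite /H; have -> : (8 * S < S + 3 + (nlow - 3)) = false by lia.
  by rewrite andbF /G3 eqxx.
have E2 : H (nlow - 3) (2 * S + m) = v.
  rewrite /H; have -> : (2 * S + m < S + 3 + (nlow - 3)) = false by lia.
  rewrite andbF /G3 /G2 /G1 eqxx; do 2 (case: eqP => [|_]; [lia|]); by [].
have lowS j : 0 < j -> nlow <= j * S by move=> j0; have := leq_mul2r S 1 j; rewrite j0 orbT; lia.
have {}E4 : M (4 * S) = n by rewrite HG // lowS.
have {}E8 : M (8 * S) = m by rewrite HG // lowS.
have {}E2 : M (2 * S + m) = v by rewrite HG // (leq_trans (lowS 2 isT)) // leq_addr.
have M24 : M (nregs + 4) = 4 * S := Hb 4 isT.
have M28 : M (nregs + 8) = 8 * S := Hb 8 isT.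
have M22 : M (nregs + 2) = 2 * S := Hb 2 isT.
pose M' := mem_upd (mem_upd (mem_upd (mem_upd M 5 n) 6 m) 4 (2 * S + m)) 7 v.
suff LM' : loaded_mem M'.
  have ne x j : nlow <= x -> j < nlow -> (x == j) = false by move=> *; apply/eqP; lia.
  have l2 : nlow <= 2 * S + m by apply: leq_trans (lowS 2 isT) (leq_addr _ _).
  cbn [wpl foldr wpi]; rewrite M24 E4.
  pose M5 := mem_upd M 5 n; rewrite -/M5.
  have -> : M5 (M5 (nregs + 8)) = m.
    have -> : M5 (nregs + 8) = 8 * S by rewrite -M28.
    by rewrite /M5 /mem_upd ne ?lowS.
  pose M6 := mem_upd M5 6 m; rewrite -/M6.
  have -> : M6 (nregs + 2) + M6 6 = 2 * S + m by rewrite /M6 /M5 /mem_upd /= M22.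
  pose M4 := mem_upd M6 4 (2 * S + m); rewrite -/M4.
  have -> : M4 (M4 4) = v.
    have -> : M4 4 = 2 * S + m by [].
    by rewrite /M4 /M6 /M5 /mem_upd !ne.
  by split; first lia.
rewrite /loaded_mem /M' /mem_upd /=; split=> //.
- move=> i lti; do 4 (case: eqP => [|_]; [lia|]); rewrite HG /H; last lia.
  have -> : (S + 3 <= S + i) && (S + i < S + 3 + (nlow - 3)) by lia.
  by rewrite addKn.
- move=> i lti; do 4 (case: eqP => [|_]; [lia|]); rewrite HG /H; last lia.
  have -> : (S + 3 <= i) = false by lia.
  by rewrite /= /G3 /G2 /G1; do 3 (case: eqP => [|_]; [lia|]).
(* All spills lie in arrays 1, 2, 4 and 8, so arrays 3 and 7 are still zero. *)
- move=> i lti; do 8 (case: eqP => [|_]; [lia|]); rewrite !HG /H; try lia.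
  have -> : (3 * S + i < S + 3 + (nlow - 3)) = false by lia.
  have -> : (7 * S + i < S + 3 + (nlow - 3)) = false by lia.
  rewrite !andbF /G3 /G2 /G1; do 6 (case: eqP => [|_]; [lia|]).
  by rewrite !D_out //; lia.
Qed.

End Prologue.

(** * Correctness *)

Lemma nth_flatten_pairs (T : Type) (f g : T -> nat) (x : T) l p : p < size l ->
  nth 0 (flatten [seq [:: f y; g y] | y <- l]) (2 * p) = f (nth x l p) /\
  nth 0 (flatten [seq [:: f y; g y] | y <- l]) (2 * p + 1) = g (nth x l p).
Proof.
elim: l p => // y l IH [|p] // ltp; have [E1 E2] := IH p ltp.
by have -> : 2 * p.+1 = (2 * p).+2 by lia.
Qed.

Lemma size_flatten_pairs (T : Type) (f g : T -> nat) (l : seq T) :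
  size (flatten [seq [:: f y; g y] | y <- l]) = 2 * size l.
Proof. by elim: l => //= y l ->; lia. Qed.

Section Correctness.

Variables (n : nat) (e : rel 'I_n) (lab : 'I_n -> bool * 'I_n).
Variables (es : seq ('I_n * 'I_n)) (v : 'I_n) (X : {set 'I_n}).
Notation m := (size es).
Let D := encode lab es v X.

Lemma n_gt0 : 0 < n.
Proof. exact: leq_ltn_trans (ltn_ord v). Qed.

Lemma encode_data a : 3 <= a ->
  D a = nth 0 ([seq nat_of_bool (lab i).1 | i <- enum 'I_n] ++
    [seq val (lab i).2 | i <- enum 'I_n] ++
    [seq nat_of_bool (i \in X) | i <- enum 'I_n] ++
    flatten [seq [:: val p.1; val p.2] | p <- es]) (a - 3).
Proof. by rewrite /D /encode; case: a => [|[|[|a]]]. Qed.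

Lemma nth_map_enum (f : 'I_n -> nat) (i : 'I_n) :
  nth 0 [seq f j | j <- enum 'I_n] i = f i.
Proof. by rewrite (nth_map i) ?size_enum_ord // nth_ord_enum. Qed.

Lemma encode_kind (w : 'I_n) : D (3 + w) = (lab w).1.
Proof. by rewrite encode_data // addKn nth_cat size_map size_enum_ord ltn_ord nth_map_enum. Qed.

Lemma encode_elem (w : 'I_n) : D (3 + n + w) = (lab w).2.
Proof.
rewrite encode_data // -!addnA addKn nth_cat size_map size_enum_ord ltnNge leq_addr /=.
by rewrite addKn nth_cat size_map size_enum_ord ltn_ord nth_map_enum.
Qed.

Lemma encode_set (w : 'I_n) : D (3 + n + n + w) = (w \in X).
Proof.
rewrite encode_data // -!addnA addKn nth_cat size_map size_enum_ord ltnNge leq_addr /=.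
rewrite addKn nth_cat size_map size_enum_ord ltnNge leq_addr /=.
by rewrite addKn nth_cat size_map size_enum_ord ltn_ord (nth_map_enum (fun i => i \in X : nat)).
Qed.

Lemma encode_tail q : D (3 + 3 * n + q) =
  nth 0 (flatten [seq [:: val p.1; val p.2] | p <- es]) q.
Proof.
rewrite encode_data; last by lia.
have -> : 3 + 3 * n + q - 3 = n + (n + (n + q)) by lia.
by do 3 rewrite nth_cat size_map size_enum_ord ltnNge leq_addr /= addKn.
Qed.

Definition nat_edges := [seq (val p.1, val p.2) | p <- es].

Lemma encode_edge p : p < m ->
  D (3 + 3 * n + 2 * p) = (nth (0, 0) nat_edges p).1 /\
  D (3 + 3 * n + 2 * p + 1) = (nth (0, 0) nat_edges p).2.
Proof.
move=> ltp; rewrite -[_ + 1]addnA !encode_tail (nth_map (v, v)) //.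
exact: (nth_flatten_pairs (fun p : 'I_n * 'I_n => val p.1) (fun p => val p.2)).
Qed.

(** Reading labels and X back from memory makes them total on numbers, as [Program] expects. *)
Definition kd w := D (3 + w) == 1.
Definition el w := D (3 + n + w).
Definition inX x := D (3 + n + n + x) == 1.

Lemma kd_ord (w : 'I_n) : kd w = (lab w).1.
Proof. by rewrite /kd encode_kind eqb1. Qed.

Lemma inX_ord (w : 'I_n) : inX w = (w \in X).
Proof. by rewrite /inX encode_set eqb1. Qed.

Lemma forall_ord (Q : nat -> Prop) : (forall w : 'I_n, Q w) -> forall w, w < n -> Q w.
Proof. by move=> H w ltw; apply: (H (Ordinal ltw)). Qed.

Hypothesis G_event : is_event_graph e lab.
Hypothesis es_e : represents e es.
Hypothesis subX : X \subset UV lab.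

Notation ini := (init n v kd el inX).
Notation arcs := (adj_of (pairs n el nat_edges)).
Notation flag := (flagged (2 * n) n arcs ini).

Lemma mem_pairs_node (u w : 'I_n) :
  ((val u, val w) \in pairs n el nat_edges) = ((u, w) \in es).
Proof.
rewrite mem_cat; apply/orP/idP => [[/mapP[[a b] ab /= [/val_inj-> /val_inj->]] //|]|uw].
  by move=> /mapP[x _ [_]]; have := ltn_ord w; lia.
by left; apply/mapP; exists (u, w).
Qed.

Lemma arc_node (u w : 'I_n) : (val w \in arcs u) = e u w.
Proof. by rewrite mem_adj_of !mem_pairs_node es_e.1. Qed.

Lemma pairs_elem a b : n <= b -> (a, b) \in pairs n el nat_edges -> a < n /\ b = n + el a.
Proof.
move=> leb; rewrite mem_cat => /orP[/mapP[[x y] _ /= [_ E]]|/mapP[x]].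
  by have := ltn_ord y; lia.
by rewrite mem_iota => ltx [-> ->].
Qed.

Lemma pairs_first a b : (a, b) \in pairs n el nat_edges -> a < n.
Proof.
rewrite mem_cat => /orP[/mapP[[x y] _ /= [-> _]] //|/mapP[x]].
by rewrite mem_iota => ltx [-> _].
Qed.

Lemma arc_elem (u : 'I_n) z : n <= z -> (z \in arcs u) = (z == n + (lab u).2).
Proof.
move=> lez; rewrite mem_adj_of -encode_elem; apply/orP/eqP => [[/(pairs_elem lez)[] //|/pairs_first]|->].
  by lia.
by left; rewrite mem_cat; apply/orP; right; apply/mapP; exists (val u); rewrite ?mem_iota /=.
Qed.

Lemma arc_from_elem z (w : 'I_n) : n <= z -> (val w \in arcs z) = (z == n + (lab w).2).
Proof. by move=> lez; rewrite -arc_elem // !mem_adj_of orbC. Qed.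

Lemma init_node (w : 'I_n) : ini false w = compat lab X w.
Proof. by rewrite /init leqNgt ltn_ord /= kd_ord /el encode_elem inX_ord. Qed.

(** The rule [found_seen] becomes a detour from [u'] through the element vertex to [w]. *)
Lemma found_flagged w : found e lab v X w -> flag true w /\ flag false w.
Proof.
have ltN (u : 'I_n) : u < 2 * n by have := ltn_ord u; lia.
have node (u : 'I_n) z : flag true u /\ flag false u -> z \in arcs u -> flag true z.
  by move=> [t f] uz; rewrite -[true](ltn_ord u); apply: flagged_arc => //.
elim=> {w} [cv|u w _ fu euw cw|u u' w _ fu euw _ fu' elw].
- by split; apply: flagged_init; [rewrite /= eqxx | rewrite init_node].
- split; first by apply: node fu _; rewrite arc_node.
  by apply: flagged_init; rewrite init_node.
split; first by apply: node fu _; rewrite arc_node.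
have lez : n <= n + (lab w).2 by apply: leq_addr.
have -> : false = (n + (lab w).2 < n) by rewrite ltnNge lez.
apply: flagged_arc; first by have := ltn_ord (lab w).2; lia.
- by apply: node fu' _; rewrite arc_elem // elw.
- by apply: flagged_init; rewrite /= lez.
by rewrite arc_from_elem.
Qed.

(* The invariant carried by a flag of a node (below n) or of an element. *)
Definition meaning b (z : nat) : Prop := if b
  then (forall w : 'I_n, z = val w -> w = v \/ exists2 u, found e lab v X u & e u w) /\
       (forall x : 'I_n, z = n + x -> exists2 u, found e lab v X u & (lab u).2 = x)
  else forall w : 'I_n, z = val w ->
    compat lab X w \/ exists2 u, found e lab v X u & (lab u).2 = (lab w).2.

Lemma meaning_found (w : 'I_n) : meaning true w -> meaning false w -> found e lab v X w.
Proof.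
move=> [/(_ w erefl) Ht _] /(_ w erefl) Hf.
case: Ht Hf => [->|[u fu euw]] [cw|[u' fu' E]].
- exact: found_start.
- exact: found_root fu'.
- exact: found_compat fu euw cw.
- exact: found_seen fu euw fu' E.
Qed.

Lemma flagged_meaning b z : flag b z -> meaning b z.
Proof.
elim=> {b z} [b z|u z ltu _ IHt _ IHf uz].
  case: b => [/eqP->|Hz w E]; last by left; rewrite -init_node -E.
  by split=> [w /val_inj->|x E]; [left | have := ltn_ord v; lia].
case: (ltnP u n) => [ltun|leun] /=.
  pose u' := Ordinal ltun; have fu : found e lab v X u' by apply: meaning_found.
  split=> [w E|x E].
    by right; exists u' => //; move: uz; rewrite E (arc_node u').
  exists u' => //; apply: val_inj; move: uz; rewrite (arc_elem u') E ?leq_addr //.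
  by rewrite eqn_add2l => /eqP.
move=> w E; right; move: uz; rewrite E arc_from_elem // => /eqP Eu.
by have [_ /(_ _ Eu)] := IHt.
Qed.

Lemma flagged_found (w : 'I_n) : flag true w -> flag false w -> found e lab v X w.
Proof. by move=> /flagged_meaning Ht /flagged_meaning Hf; apply: meaning_found. Qed.

Lemma flagged_sink : (forall w, w < n -> flag true w /\ flag false w) <->
  in_sink_component e lab (v, X).
Proof.
split=> [H|H].
  by apply: found_sink => // w; case: (H w (ltn_ord w)); apply: flagged_found.
by apply: forall_ord => w; apply: found_flagged; apply: sink_found.
Qed.

End Correctness.

(** * The whole program and its bounds *)

Definition program := prologue ++ compile (size prologue) main_cmd.

Lemma exec_halt P W k pc M : size P <= pc -> exec P W k pc M = Some M.
Proof. by move=> le; case: k => [|k] /=; rewrite /step nth_default. Qed.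

(** One factor absorbs s and eleven absorb 1280 = 20 * 64, which is below 2 ^ 11. *)
Lemma linear_le_exp s c : 11 < c -> 1280 * s <= (s + 2) ^ c.
Proof.
case: c => // c; rewrite ltnS => lec; rewrite expnS mulnC; apply: leq_mul; first exact: leq_addr.
apply: (@leq_trans (2 ^ 11)) => //.
apply: leq_trans (leq_pexp2l (isT : 0 < 2) lec) _.
by rewrite leq_exp2r ?leq_addl //; apply: leq_trans lec.
Qed.

Lemma program_correct n (e : rel 'I_n) lab es (v : 'I_n) (X : {set 'I_n}) W t :
  is_event_graph e lab -> represents e es -> X \subset UV lab ->
  20 * (64 * (n + size es)) <= W ->
  size prologue + (500 * (n + size es) + 500) <= t ->
  exists Mf, exec program W t 0 (encode lab es v X) = Some Mf /\
    (Mf 0 == 1) = in_sink_component e lab (v, X).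
Proof.
move=> G_event es_e subX leW let_.
have n_pos := n_gt0 v.
set D := encode lab es v X; set S := 64 * (n + size es).
have lt_edges : all (fun p => (p.1 < n) && (p.2 < n)) (nat_edges es).
  by apply/allP=> p /mapP[q _ ->] /=; rewrite !ltn_ord.
have [code1 code2] : code_at program 0 prologue /\
    code_at program (0 + size prologue) (compile (size prologue) main_cmd).
  exact: code_at_cat.
(* The input fills 3 + 3n + 2m cells, which is at most S as n is positive. *)
have D_out a : S <= a -> D a = 0.
  move=> lea; rewrite /D encode_data; last by lia.
  rewrite nth_default // 3!size_cat 3!size_map size_enum_ord size_flatten_pairs.
  by move: lea n_pos; rewrite /S; move: (size es); clear; lia.
have Hpro := prologue_wpl n_pos (ltn_ord v) leW (erefl : D 0 = n)
  (erefl : D 1 = size es) (erefl : D 2 = v) D_out (fun=> erefl).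
have [M1 [[M5 M6 M7] Mb Md1 Md0 Mz] S1] := wpl_steps Hpro code1.
pose s1 := State M1 (fun j i => M1 (j * S + i)).
have rel1 : encodes S s1 M1 by split=> // j lt; rewrite -Mb.
have load1 : loaded n (size es) v S D s1.
  by split=> //= i lti; rewrite mul1n Md1.
have leD : forall w, w < n -> D (3 + w) = kd lab es v X w.
  by apply: forall_ord => w; rewrite /D kd_ord encode_kind.
have leE : forall w, w < n -> el lab es v X w < n.
  by apply: forall_ord => w; rewrite /el encode_elem.
have leX : forall w, w < n -> D (3 + n + n + w) = inX lab es v X w.
  by apply: forall_ord => w; rewrite /D inX_ord encode_set.
have T := main_triple n_pos (ltn_ord v) (erefl S) leW leD (fun _ _ => erefl) leE leX
  (size_map _ _) lt_edges (@encode_edge n lab es v X) load1.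
have [t2 [s2 [M2 [le2 acc2 rel2 S2]]]] := T _ _ _ code2 rel1.
exists M2; split.
  have -> : t = size prologue + t2 + (t - (size prologue + t2)) by lia.
  rewrite (steps_trans S1 S2) add0n -size_cat.
  exact: exec_halt (leqnn _).
have [r0 _ _] := rel2; rewrite (r0 0 isT).
have [H1 H2] := iff_trans acc2 (flagged_sink v G_event es_e subX).
exact/idP/idP.
Qed.

Theorem mainTheorem6 :
  exists (P : seq instr) (c : nat),
    forall (n : nat) (e : rel 'I_n) (lab : 'I_n -> bool * 'I_n)
           (es : seq ('I_n * 'I_n)) (v : 'I_n) (X : {set 'I_n}),
      is_event_graph e lab ->
      represents e es ->
      X \subset UV lab ->
      exists Mf : nat -> nat,
        exec P ((n + size es + 2) ^ c) (c * (n + size es)) 0 (encode lab es v X)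
          = Some Mf /\
        (Mf 0 == 1) = in_sink_component e lab (v, X).
Proof.
(* As n + m is at least 1, a factor 1000 covers 500 (n + m) + 500, and [size prologue] covers the
   straight-line prologue. *)
exists program, (1000 + size prologue) => n e lab es v X G_event es_e subX.
have n_pos := n_gt0 v.
apply: program_correct => //.
  by rewrite mulnA; apply: linear_le_exp; rewrite ltn_addr.
have : size prologue * 1 <= size prologue * (n + size es) by rewrite leq_mul2l; lia.
by rewrite mulnDl; lia.
Qed.
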